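(* Fix $z\in(0,1/4)$. The function $x\mapsto zQ(x,0,z)$, holomorphic in the unit disc, can be continued as a holomorphic function to $\mathbb{C}\setminus[x_3,x_4]$, and the function $y\mapsto z(y+1)Q(0,y,z)$, holomorphic in the unit disc, can be continued as a holomorphic function to $\mathbb{C}\setminus[y_3,y_4]$. Moreover, with these continuations, for every $y\in\mathbb{C}\setminus([y_1,y_2]\cup[y_3,y_4])$, $$zQ(X_0(y),0,z)+z(y+1)Q(0,y,z)-zQ(0,0,z)-X_0(y)y=0,$$ and for every $x\in\mathbb{C}\setminus([x_1,x_2]\cup[x_3,x_4])$, $$zQ(x,0,z)+z(Y_0(x)+1)Q(0,Y_0(x),z)-zQ(0,0,z)-xY_0(x)=0.$$
   Context: Gessel's walks are lattice walks in $\mathbb{Z}_+^2$ starting at $(0,0)$, with unit steps $(-1,0)$, $(1,1)$, $(1,0)$, $(-1,-1)$, never leaving $\mathbb{Z}_+^2$. Let $q(i,j,k)$ be the number of such walks of length $k$ ending at $(i,j)$, and $Q(x,y,z)=\sum_{i,j,k\ge0}q(i,j,k)x^iy^jz^k$ (convergent for $|x|\le1,|y|\le1,|z|<1/4$). Fix $z\in(0,1/4)$ and set $\tilde a(y)=zy(y+1)$, $\tilde b(y)=-y$, $\tilde c(y)=z(y+1)$, $a(x)=zx^2$, $b(x)=zx^2-x+z$, $c(x)=z$, so that $xyz(1/x+1/(xy)+x+xy-1/z)=\tilde a(y)x^2+\tilde b(y)x+\tilde c(y)=a(x)y^2+b(x)y+c(x)$; put $\tilde d=\tilde b^2-4\tilde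 a\tilde c$ and $d=b^2-4ac$. The roots of $\tilde d$ are $y_1=0$, $y_2=[1-8z^2-(1-16z^2)^{1/2}]/(8z^2)$, $y_3=[1-8z^2+(1-16z^2)^{1/2}]/(8z^2)$, and one sets $y_4=\infty$; the roots of $d$ are $x_1=[1+2z-(1+4z)^{1/2}]/(2z)$, $x_2=[1-2z-(1-4z)^{1/2}]/(2z)$, $x_3=[1-2z+(1-4z)^{1/2}]/(2z)$, $x_4=[1+2z+(1+4z)^{1/2}]/(2z)$, with $0<x_1<x_2<1<x_3<x_4$ and $0<y_2<1<y_3$. The two branches $X_0,X_1$ of the algebraic function $X(y)$ defined by $\tilde a(y)X^2+\tilde b(y)X+\tilde c(y)=0$, namely $(-\tilde b(y)\pm\tilde d(y)^{1/2})/(2\tilde a(y))$, are meromorphic on $\mathbb{C}\setminus([y_1,y_2]\cup[y_3,y_4])$ and labeled so that $|X_0(y)|\le|X_1(y)|$; similarly $Y_0,Y_1$, the branches $(-b(x)\pm d(x)^{1/2})/(2a(x))$ of the roots of $a(x)Y^2+b(x)Y+c(x)=0$, are meromorphic on $\mathbb{C}\setminus([x_1,x_2]\cup[x_3,x_4])$ with $|Y_0(x)|\le|Y_1(x)|$. *)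

(* Defs.v *)
From Stdlib Require Import Reals List ZArith Bool.
From Coquelicot Require Import Coquelicot.
Import ListNotations.
Open Scope R_scope.
Open Scope bool_scope.

Inductive step := W | NE | E | SW.
Definition dx (s : step) : Z := match s with W => -1 | NE => 1 | E => 1 | SW => -1 end%Z.
Definition dy (s : step) : Z := match s with W => 0 | NE => 1 | E => 0 | SW => -1 end%Z.

Fixpoint all_seqs (k : nat) : list (list step) :=
  match k with
  | O => [ [] ]
  | S k' => flat_map (fun w => map (fun s => s :: w) [W; NE; E; SW]) (all_seqs k')
  end.

(** The walk starting from p with steps w never leaves Z_+^2 (p itself assumed in it). *)
Fixpoint stays (p : Z * Z) (w : list step) : bool :=
  match w with
  | [] => true
  | s :: w' =>
      let p' := (fst p + dx s, snd p + dy s)%Z in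
      (0 <=? fst p')%Z && (0 <=? snd p')%Z && stays p' w'
  end.

Fixpoint endpt (p : Z * Z) (w : list step) : Z * Z :=
  match w with
  | [] => p
  | s :: w' => endpt (fst p + dx s, snd p + dy s)%Z w'
  end.

Definition q (i j k : nat) : nat :=
  length (filter (fun w => stays (0, 0)%Z w
                          && Z.eqb (fst (endpt (0, 0)%Z w)) (Z.of_nat i)
                          && Z.eqb (snd (endpt (0, 0)%Z w)) (Z.of_nat j))
                 (all_seqs k)).

Definition csum (f : nat -> C) (n : nat) : C :=
  fold_right Cplus (RtoC 0) (map f (seq 0 (S n))).

(** k-th homogeneous part in z: z^k * sum_{i,j} q(i,j,k) x^i y^j
    (q(i,j,k) = 0 unless i,j <= k). *)
Definition Qterm (x y : C) (z : R) (k : nat) : C :=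
  Cmult (RtoC (z ^ k))
    (csum (fun i => csum (fun j =>
       Cmult (RtoC (INR (q i j k))) (Cmult (Cpow x i) (Cpow y j))) k) k).

Definition Q (x y : C) (z : R) : C :=
  (Series (fun k => Re (Qterm x y z k)), Series (fun k => Im (Qterm x y z k))).

Definition y1 (z : R) : R := 0.
Definition y2 (z : R) : R := (1 - 8 * z ^ 2 - sqrt (1 - 16 * z ^ 2)) / (8 * z ^ 2).
Definition y3 (z : R) : R := (1 - 8 * z ^ 2 + sqrt (1 - 16 * z ^ 2)) / (8 * z ^ 2).
Definition x1 (z : R) : R := (1 + 2 * z - sqrt (1 + 4 * z)) / (2 * z).
Definition x2 (z : R) : R := (1 - 2 * z - sqrt (1 - 4 * z)) / (2 * z).
Definition x3 (z : R) : R := (1 - 2 * z + sqrt (1 - 4 * z)) / (2 * z).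
Definition x4 (z : R) : R := (1 + 2 * z + sqrt (1 + 4 * z)) / (2 * z).

Definition on_seg (lo hi : R) (w : C) : Prop := Im w = 0 /\ lo <= Re w <= hi.
Definition on_ray (lo : R) (w : C) : Prop := Im w = 0 /\ lo <= Re w.

Definition csqrt (w : C) : C :=
  (sqrt ((Cmod w + Re w) / 2),
   if Rle_dec 0 (Im w) then sqrt ((Cmod w - Re w) / 2)
   else - sqrt ((Cmod w - Re w) / 2)).

Definition Cis0 (w : C) : bool :=
  if Req_EM_T (Re w) 0 then (if Req_EM_T (Im w) 0 then true else false) else false.

(** the root of A T^2 + B T + Cc = 0 of smaller modulus; when A = 0 the
    (removable) value -Cc/B of the bounded branch. *)
Definition small_root (A B Cc : C) : C :=
  if Cis0 A then (if Cis0 B then RtoC 0 else Copp (Cdiv Cc B))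
  else
    let s := csqrt (Cminus (Cmult B B) (Cmult (RtoC 4) (Cmult A Cc))) in
    let r1 := Cdiv (Cplus (Copp B) s) (Cmult (RtoC 2) A) in
    let r2 := Cdiv (Cminus (Copp B) s) (Cmult (RtoC 2) A) in
    if Rle_dec (Cmod r1) (Cmod r2) then r1 else r2.

Definition X0 (z : R) (y : C) : C :=
  small_root (Cmult (RtoC z) (Cmult y (Cplus y (RtoC 1)))) (Copp y)
             (Cmult (RtoC z) (Cplus y (RtoC 1))).

Definition Y0 (z : R) (x : C) : C :=
  small_root (Cmult (RtoC z) (Cmult x x))
             (Cplus (Cminus (Cmult (RtoC z) (Cmult x x)) x) (RtoC z)) (RtoC z).

Definition holo_on (D : C -> Prop) (f : C -> C) : Prop :=
  forall w, D w -> @ex_derive C_AbsRing C_NormedModule f w.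

(* Main.v *)
(** The kernel method. The polynomials counting walks of length [k] satisfy a recursion whose
    generating form is [K(x,y) Q(x,y) = z Q(x,0) + z (y+1) Q(0,y) - z Q(0,0) - x y], valid for
    [|x|, |y| <= 1], so the right-hand side vanishes wherever the kernel [K] does.

    Off the cuts the two branches have distinct moduli. Since [X0 X1 = 1/y] and [Y0 Y1 = 1/x^2], this gives
    [|y| |X0(y)|^2 < 1] and [|x| |Y0(x)| < 1]. In particular [|X0(y)| < 1] when [|y| >= 1], so
    [X0(y) y + z Q(0,0) - z Q(X0(y),0)] continues [z (y+1) Q(0,y)] beyond the unit disc: on the
    overlap [|y| < 1], [|X0(y)| < 1] the two expressions agree by the kernel identity, without
    any appeal to the identity theorem. The continuation in [x] is symmetric. The equation in [y] is
    then immediate if [|X0(y)| < 1]; otherwise [|y| < 1] and [|X0(y)| |y| < 1], which forces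
    [Y0(X0(y)) = y], and it is the definition of the continuation at [X0(y)]. *)
Require Import Defs.
From Stdlib Require Import Reals List ZArith Bool Lia Lra.
From Coquelicot Require Import Coquelicot.
Import ListNotations.
Open Scope R_scope.

(** * Counting walks by their last step *)

Definition padd (p : Z * Z) (s : step) : Z * Z := (fst p + dx s, snd p + dy s)%Z.
Definition psub (p : Z * Z) (s : step) : Z * Z := (fst p - dx s, snd p - dy s)%Z.
Definition inquad (p : Z * Z) : bool := ((0 <=? fst p)%Z && (0 <=? snd p)%Z)%bool.
Definition steps : list step := [W; NE; E; SW].
Definition sumsteps (f : step -> nat) : nat := list_sum (map f steps).

(** [stays] and [endpt] read a word from its first step, so the start point [p] has to vary in the
    inductions; [q] is the case where [p] is the origin. *)
Definition wcount (k : nat) (p t : Z * Z) : nat :=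
  length (filter (fun w => stays p w
                          && Z.eqb (fst (endpt p w)) (fst t)
                          && Z.eqb (snd (endpt p w)) (snd t))%bool
                 (all_seqs k)).

Lemma length_filter_cons_steps (f : list step -> bool) (l : list (list step)) :
  length (filter f (flat_map (fun w => map (fun s => s :: w) steps) l)) =
  sumsteps (fun s => length (filter (fun w => f (s :: w)) l)).
Proof.
  induction l as [|w l IH]; [reflexivity|].
  cbn [flat_map]. rewrite filter_app, length_app, IH.
  unfold sumsteps; cbn.
  destruct (f (W :: w)), (f (NE :: w)), (f (E :: w)), (f (SW :: w)); cbn; lia.
Qed.

Lemma filter_false {A : Type} (l : list A) : filter (fun _ => false) l = [].
Proof. now induction l. Qed.

Lemma wcount_first_step (k : nat) (p t : Z * Z) :
  wcount (S k) p t =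
  sumsteps (fun s => if inquad (padd p s) then wcount k (padd p s) t else 0%nat).
Proof.
  unfold wcount at 1. cbn [all_seqs]. fold steps.
  rewrite length_filter_cons_steps.
  unfold sumsteps. f_equal. apply map_ext. intros s.
  cbn [stays endpt]. fold (padd p s). unfold inquad.
  destruct (0 <=? fst (padd p s))%Z, (0 <=? snd (padd p s))%Z; cbn;
    first [reflexivity | now rewrite filter_false].
Qed.

Lemma wcount_0 (p t : Z * Z) :
  wcount 0 p t = if (Z.eqb (fst p) (fst t) && Z.eqb (snd p) (snd t))%bool then 1%nat else 0%nat.
Proof.
  unfold wcount. cbn.
  destruct (fst p =? fst t)%Z, (snd p =? snd t)%Z; reflexivity.
Qed.

(** With the start fixed at the origin, the recursion needed is on the last step, whereas words are
    built at the front. The induction peels the first step, applies the hypothesis to the rest for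
    every start, and exchanges the two sums over steps. *)
Lemma wcount_last_step (k : nat) (p t : Z * Z) :
  wcount (S k) p t =
  if inquad t then sumsteps (fun s => wcount k p (psub t s)) else 0%nat.
Proof.
  revert p; induction k as [|k IH]; intros p.
  - rewrite wcount_first_step.
    transitivity (sumsteps (fun s => if inquad t then wcount 0 p (psub t s) else 0%nat)).
    + unfold sumsteps. f_equal. apply map_ext. intros s. rewrite !wcount_0.
      assert (E : (Z.eqb (fst (padd p s)) (fst t) && Z.eqb (snd (padd p s)) (snd t))%bool =
        (Z.eqb (fst p) (fst (psub t s)) && Z.eqb (snd p) (snd (psub t s)))%bool).
      { unfold padd, psub. cbn [fst snd]. apply eq_true_iff_eq.
        rewrite !andb_true_iff, !Z.eqb_eq. lia. }
      rewrite <- E. unfold inquad.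
      destruct (Z.eqb_spec (fst (padd p s)) (fst t)) as [->|_];
        destruct (Z.eqb_spec (snd (padd p s)) (snd t)) as [->|_]; cbn [andb];
        repeat match goal with |- context [if ?b then _ else _] => destruct b end; reflexivity.
    + now destruct (inquad t).
  - rewrite wcount_first_step.
    transitivity (sumsteps (fun s => if inquad (padd p s) then
       if inquad t then sumsteps (fun s' => wcount k (padd p s) (psub t s')) else 0%nat
       else 0%nat)).
    { unfold sumsteps. f_equal. apply map_ext. intros s. now rewrite IH. }
    destruct (inquad t).
    + unfold sumsteps, steps. cbn [map]. rewrite !wcount_first_step.
      unfold sumsteps, steps. cbn [map list_sum fold_right].
      destruct (inquad (padd p W)), (inquad (padd p NE)), (inquad (padd p E)),
        (inquad (padd p SW)); lia.
    + unfold sumsteps, steps. cbn.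
      destruct (inquad (padd p W)), (inquad (padd p NE)), (inquad (padd p E)),
        (inquad (padd p SW)); reflexivity.
Qed.

(** For length 0 this uses that the origin itself lies in the quadrant; every longer walk has its
    end point tested by [stays]. *)
Lemma wcount_outside (k : nat) (t : Z * Z) :
  inquad t = false -> wcount k (0, 0)%Z t = 0%nat.
Proof.
  intros Ht. destruct k as [|k].
  - rewrite wcount_0. unfold inquad in Ht. cbn.
    destruct t as [a b]; cbn in *.
    destruct a, b; cbn in *; congruence.
  - now rewrite wcount_last_step, Ht.
Qed.

Lemma q_wcount (i j k : nat) : q i j k = wcount k (0, 0)%Z (Z.of_nat i, Z.of_nat j).
Proof. reflexivity. Qed.

Lemma wcount_far (k : nat) (t : Z * Z) :
  (Z.of_nat k < fst t \/ Z.of_nat k < snd t)%Z -> wcount k (0, 0)%Z t = 0%nat.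
Proof.
  revert t; induction k as [|k IH]; intros [a b] Ht.
  - rewrite wcount_0. cbn in *.
    destruct a, b; cbn in *; try reflexivity; lia.
  - rewrite wcount_last_step. destruct (inquad _); [|reflexivity].
    unfold sumsteps, steps, psub. cbn [map list_sum fold_right fst snd dx dy].
    rewrite !IH; [reflexivity|..]; cbn [fst snd] in *; lia.
Qed.

Lemma q_far (i j k : nat) : (k < i \/ k < j)%nat -> q i j k = 0%nat.
Proof. intros H. rewrite q_wcount. apply wcount_far. cbn. lia. Qed.

(** The summands belong to the last steps [W], [SW], [E], [NE], in this order. Predecessors with a
    negative coordinate contribute nothing, hence the matches on [i] and [j]. *)
Lemma q_S (i j k : nat) :
  q i j (S k) =
  (q (S i) j k + q (S i) (S j) k
   + match i with 0 => 0 | S i' => q i' j k + match j with 0 => 0 | S j' => q i' j' k end end)%nat.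
Proof.
  rewrite !q_wcount, wcount_last_step.
  replace (inquad (Z.of_nat i, Z.of_nat j)) with true
    by (symmetry; unfold inquad; cbn [fst snd]; apply andb_true_intro; split; apply Z.leb_le; lia).
  unfold sumsteps, steps, psub. cbn [map list_sum fold_right fst snd dx dy].
  replace (Z.of_nat i - -1)%Z with (Z.of_nat (S i)) by lia.
  replace (Z.of_nat j - -1)%Z with (Z.of_nat (S j)) by lia.
  replace (Z.of_nat j - 0)%Z with (Z.of_nat j) by lia.
  destruct i as [|i].
  - rewrite (wcount_outside k (Z.of_nat 0 - 1, Z.of_nat j - 1)%Z) by reflexivity.
    rewrite (wcount_outside k (Z.of_nat 0 - 1, Z.of_nat j)%Z) by reflexivity.
    lia.
  - replace (Z.of_nat (S i) - 1)%Z with (Z.of_nat i) by lia.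
    destruct j as [|j].
    + rewrite (wcount_outside k (Z.of_nat i, Z.of_nat 0 - 1)%Z)
        by (unfold inquad; cbn [fst snd]; apply andb_false_r).
      rewrite q_wcount. lia.
    + replace (Z.of_nat (S j) - 1)%Z with (Z.of_nat j) by lia.
      rewrite !q_wcount. lia.
Qed.

Lemma q_0 : q 0 0 0 = 1%nat.
Proof. reflexivity. Qed.

(** * The counting polynomials *)

Lemma csum_0 (f : nat -> C) : csum f 0 = f 0%nat.
Proof. unfold csum. cbn -[Cplus]. apply Cplus_0_r. Qed.

Lemma fold_right_Cplus_init (l : list C) (a : C) :
  fold_right Cplus a l = (fold_right Cplus (RtoC 0) l + a)%C.
Proof.
  induction l as [|b l IH]; cbn -[Cplus]; [now rewrite Cplus_0_l|].
  rewrite IH. ring.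
Qed.

Lemma csum_S (f : nat -> C) (n : nat) : csum f (S n) = (csum f n + f (S n))%C.
Proof.
  unfold csum. rewrite (seq_S (S n) 0), map_app, fold_right_app.
  rewrite fold_right_Cplus_init. cbn -[Cplus seq]. now rewrite Cplus_0_r.
Qed.

Lemma csum_ext (f g : nat -> C) (n : nat) :
  (forall i, (i <= n)%nat -> f i = g i) -> csum f n = csum g n.
Proof.
  induction n as [|n IH]; intros H; rewrite ?csum_0, ?csum_S.
  - apply H; lia.
  - rewrite IH by (intros; apply H; lia). now rewrite H by lia.
Qed.

Lemma csum_plus (f g : nat -> C) (n : nat) :
  csum (fun i => f i + g i)%C n = (csum f n + csum g n)%C.
Proof. induction n as [|n IH]; rewrite ?csum_0, ?csum_S, ?IH; ring. Qed.

Lemma csum_scal (a : C) (f : nat -> C) (n : nat) :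
  csum (fun i => a * f i)%C n = (a * csum f n)%C.
Proof. induction n as [|n IH]; rewrite ?csum_0, ?csum_S, ?IH; ring. Qed.

Lemma csum_pad (f : nat -> C) (n m : nat) :
  (n <= m)%nat -> (forall i, (n < i)%nat -> f i = RtoC 0) -> csum f m = csum f n.
Proof.
  intros Hnm Hf. induction Hnm as [|m Hnm IH]; [reflexivity|].
  rewrite csum_S, IH, Hf by lia. ring.
Qed.

(** Finite sums keep boundary terms at both ends: the lower one produces the sections at 0 of the
    counting polynomials, the upper one vanishes once [n] exceeds the degree. *)
Lemma csum_shift_down (u : nat -> C) (x : C) (n : nat) :
  (x * csum (fun i => u (S i) * x ^ i) n)%C =
  (csum (fun i => u i * x ^ i) n - u 0%nat + u (S n) * x ^ (S n))%C.
Proof.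
  induction n as [|n IH]; rewrite ?csum_0, ?csum_S.
  - rewrite Cpow_S. cbn [Cpow]. ring.
  - rewrite Cmult_plus_distr_l, IH, (Cpow_S x (S n)). ring.
Qed.

Lemma csum_shift_up (v : nat -> C) (x : C) (n : nat) :
  csum (fun i => (match i with O => RtoC 0 | S i' => v i' end) * x ^ i)%C n =
  (x * csum (fun i => v i * x ^ i) n - v n * x ^ (S n))%C.
Proof.
  induction n as [|n IH]; rewrite ?csum_0, ?csum_S.
  - rewrite Cpow_S. cbn [Cpow]. ring.
  - rewrite IH, !(Cpow_S x (S n)). ring.
Qed.

Lemma csum_RtoC (f : nat -> R) (n : nat) :
  csum (fun i => RtoC (f i)) n = RtoC (sum_f_R0 f n).
Proof.
  induction n as [|n IH]; rewrite ?csum_0, ?csum_S; [reflexivity|].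
  now rewrite IH, <- RtoC_plus.
Qed.

Lemma Cmod_csum (f : nat -> C) (n : nat) :
  Cmod (csum f n) <= sum_f_R0 (fun i => Cmod (f i)) n.
Proof.
  induction n as [|n IH]; rewrite ?csum_0, ?csum_S; cbn [sum_f_R0]; [lra|].
  eapply Rle_trans; [apply Cmod_triangle|]. lra.
Qed.

Definition qC (i j k : nat) : C := RtoC (INR (q i j k)).

(** Since [q i j k = 0] as soon as [i] or [j] exceeds [k], any bound [n >= k] gives the same polynomial. *)
Definition wpoly_upto (n k : nat) (x y : C) : C :=
  csum (fun i => csum (fun j => qC i j k * y ^ j) n * x ^ i)%C n.

Definition wpoly (k : nat) (x y : C) : C := wpoly_upto k k x y.

Lemma qC_far (i j k : nat) : (k < i \/ k < j)%nat -> qC i j k = RtoC 0.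
Proof. intros H. unfold qC. now rewrite q_far. Qed.

Lemma csum_const0 (n : nat) : csum (fun _ => RtoC 0) n = RtoC 0.
Proof. induction n as [|n IH]; rewrite ?csum_0, ?csum_S, ?IH; ring. Qed.

Lemma csum_zero (f : nat -> C) (n : nat) :
  (forall i, (i <= n)%nat -> f i = RtoC 0) -> csum f n = RtoC 0.
Proof. intros H. rewrite (csum_ext f (fun _ => RtoC 0)) by exact H. apply csum_const0. Qed.

Lemma wpoly_upto_eq (n k : nat) (x y : C) :
  (k <= n)%nat -> wpoly_upto n k x y = wpoly k x y.
Proof.
  intros H. unfold wpoly, wpoly_upto.
  rewrite (csum_pad _ k n H).
  - apply csum_ext. intros i Hi. f_equal.
    apply csum_pad; [exact H|]. intros j Hj. rewrite qC_far by lia. ring.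
  - intros i Hi. rewrite csum_zero; [ring|]. intros j _. rewrite qC_far by lia. ring.
Qed.

Lemma csum_at_0 (a : nat -> C) (n : nat) :
  csum (fun i => a i * RtoC 0 ^ i)%C n = a 0%nat.
Proof.
  induction n as [|n IH]; rewrite ?csum_0, ?csum_S, ?IH.
  - cbn [Cpow]. ring.
  - rewrite Cpow_S. ring.
Qed.

Lemma wpoly_x_0 (k : nat) (x : C) :
  wpoly k x (RtoC 0) = csum (fun i => qC i 0 k * x ^ i)%C k.
Proof.
  unfold wpoly, wpoly_upto. apply csum_ext. intros i _. now rewrite csum_at_0.
Qed.

Lemma wpoly_0_y (k : nat) (y : C) :
  wpoly k (RtoC 0) y = csum (fun j => qC 0 j k * y ^ j)%C k.
Proof. unfold wpoly, wpoly_upto. now rewrite csum_at_0. Qed.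

Lemma qC_S (i j k : nat) :
  qC i j (S k) =
  (qC (S i) j k + qC (S i) (S j) k
   + match i with
     | O => RtoC 0
     | S i' => qC i' j k + match j with O => RtoC 0 | S j' => qC i' j' k end
     end)%C.
Proof.
  unfold qC. rewrite q_S, !plus_INR, !RtoC_plus.
  destruct i as [|i]; [reflexivity|]. rewrite plus_INR, RtoC_plus.
  destruct j; reflexivity.
Qed.

(** This is [q_S] multiplied by [x^(i+1) y^(j+1)] and summed. The subtracted sections are the steps
    that would leave the quadrant; [SW] from the origin is subtracted twice, so it is added back. *)
Lemma wpoly_S (k : nat) (x y : C) :
  (x * y * wpoly (S k) x y)%C =
  ((y + RtoC 1 + x * x * y + x * x * y * y) * wpoly k x y
   - (y + RtoC 1) * wpoly k (RtoC 0) y - wpoly k x (RtoC 0) + wpoly k (RtoC 0) (RtoC 0))%C.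
Proof.
  (* One bound serves both lengths: it is exact for length [S k], and for length [k] it leaves a
     spare zero coefficient that kills the upper boundary terms. *)
  set (n := S k).
  set (r := fun i => csum (fun j => qC i j k * y ^ j)%C n).
  (* Here [r] is a row of the polynomial of length [k]; after multiplication by [y], [e] collects
     the steps [W] and [SW] (the latter only from height at least 1) and [g] the steps [E] and
     [NE]. *)
  set (e := fun i => ((y + RtoC 1) * r i - qC i 0 k)%C).
  set (g := fun i => ((y + y * y) * r i)%C).
  assert (Hrow : forall i, (y * csum (fun j => qC i j n * y ^ j) n)%C =
                 (e (S i) + match i with O => RtoC 0 | S i' => g i' end)%C).
  { intros i.
    set (up := match i with O => RtoC 0 | S i' => r i' end).
    assert (E : csum (fun j => qC i j n * y ^ j)%C n =
      (r (S i) + csum (fun j => qC (S i) (S j) k * y ^ j) n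
       + (up + y * up))%C).
    { unfold r. rewrite <- csum_plus.
      destruct i as [|i]; unfold up.
      - rewrite Cmult_0_r, !Cplus_0_r. apply csum_ext. intros j _.
        unfold n. rewrite qC_S. ring.
      - assert (E2 : (y * r i)%C = csum (fun j => (match j with O => RtoC 0 | S j' => qC i j' k end) * y ^ j)%C n).
        { rewrite csum_shift_up. rewrite (qC_far i n k) by (unfold n; lia). unfold r. ring. }
        rewrite E2. unfold r. rewrite <- !csum_plus. apply csum_ext. intros j _.
        unfold n. rewrite qC_S. ring. }
    rewrite E.
    replace (y * (r (S i) + csum (fun j => qC (S i) (S j) k * y ^ j) n + (up + y * up)))%C
      with (y * r (S i) + y * csum (fun j => qC (S i) (S j) k * y ^ j) n + (y + y * y) * up)%C
      by ring.
    rewrite (csum_shift_down (fun j => qC (S i) j k)).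
    rewrite (qC_far (S i) (S n) k) by (unfold n; lia).
    unfold e, g, up. fold (r (S i)). destruct i; ring. }
  change (wpoly n x y) with (wpoly_upto n n x y).
  assert (Hz : forall i, (k < i)%nat -> r i = RtoC 0).
  { intros i Hi. apply csum_zero. intros j _. rewrite qC_far by lia. ring. }
  assert (E : (y * wpoly_upto n n x y)%C =
    (csum (fun i => e (S i) * x ^ i) n
    + csum (fun i => (match i with O => RtoC 0 | S i' => g i' end) * x ^ i) n)%C).
  { unfold wpoly_upto. rewrite <- csum_scal, <- csum_plus. apply csum_ext. intros i _.
    rewrite Cmult_assoc, Hrow. ring. }
  rewrite <- (Cmult_assoc x y), E, Cmult_plus_distr_l, csum_shift_down, csum_shift_up.
  assert (Ee : csum (fun i => e i * x ^ i)%C n =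
    ((y + RtoC 1) * wpoly_upto n k x y - wpoly_upto n k x (RtoC 0))%C).
  { unfold wpoly_upto. rewrite <- csum_scal.
    replace (csum (fun i => csum (fun j => qC i j k * RtoC 0 ^ j) n * x ^ i)%C n)
      with (csum (fun i => qC i 0 k * x ^ i)%C n)
      by (apply csum_ext; intros i _; now rewrite csum_at_0).
    transitivity (csum (fun i => (y + RtoC 1) * (r i * x ^ i)) n
                  + csum (fun i => RtoC (-1) * (qC i 0 k * x ^ i)) n)%C.
    - rewrite <- csum_plus. apply csum_ext. intros i _. unfold e. ring.
    - rewrite (csum_scal (RtoC (-1))). unfold r. ring. }
  assert (Eg : csum (fun i => g i * x ^ i)%C n = ((y + y * y) * wpoly_upto n k x y)%C).
  { unfold wpoly_upto. rewrite <- csum_scal. apply csum_ext. intros i _. unfold g, r. ring. }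
  rewrite Ee, Eg.
  assert (E0 : e 0%nat = ((y + RtoC 1) * wpoly k (RtoC 0) y - wpoly k (RtoC 0) (RtoC 0))%C).
  { unfold e. rewrite <- !(wpoly_upto_eq n k) by (unfold n; lia).
    unfold wpoly_upto. rewrite !csum_at_0. reflexivity. }
  rewrite E0, !wpoly_upto_eq by (unfold n; lia).
  unfold e, g. rewrite !Hz by (unfold n; lia).
  rewrite qC_far by (unfold n; lia). ring.
Qed.

Lemma wpoly_0 (x y : C) : wpoly 0 x y = RtoC 1.
Proof.
  unfold wpoly, wpoly_upto. rewrite !csum_0. unfold qC. rewrite q_0. cbn [Cpow INR]. ring.
Qed.

(** * Complex differentiability *)

(** [C_NormedModule] carries the product uniform structure; the calculus lemmas for products and
    compositions need the one induced by [Cmod], with the same norm, hence the same derivatives. *)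
Notation CN := (AbsRing_NormedModule C_AbsRing).
Notation CU := (AbsRing_UniformSpace C_AbsRing).
Notation Cdiff := (@ex_derive C_AbsRing CN).
Notation Cnear := (@locally CU).

Lemma Cdiff_ex_derive (f : C -> C) (w : C) :
  Cdiff f w -> @ex_derive C_AbsRing C_NormedModule f w.
Proof.
  intros [l [[H1 H2 H3] H0]]. exists l. split; [split|].
  - exact H1.
  - exact H2.
  - exact H3.
  - exact H0.
Qed.

Lemma Cnear_intro (w : C) (P : C -> Prop) (d : R) :
  0 < d -> (forall v : C, Cmod (v - w)%C < d -> P v) -> Cnear w P.
Proof. intros Hd H. exists (mkposreal d Hd). intros v Hv. exact (H v Hv). Qed.

(** A quadratic bound on the remainder of the linear approximation is the form in which the inverse,
    the square root and the power series are all differentiated. *)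
Lemma Cdiff_quadratic (f : C -> C) (w l : C) (M : R) :
  Cnear w (fun v : C => Cmod (f v - f w - (v - w) * l)%C <= M * (Cmod (v - w)%C) ^ 2) ->
  Cdiff f w.
Proof.
  intros H. exists l. split.
  - exact (@is_linear_scal_l C_AbsRing CN l).
  - intros x Hx. apply (@is_filter_lim_locally_unique C_AbsRing CN) in Hx. subst x.
    intros eps.
    (* [M] may be of any sign; this replacement is a positive upper bound by which [eps] can be
       divided. *)
    assert (HM : 0 < Rmax M 0 + 1) by (pose proof (Rmax_r M 0); lra).
    assert (Hd : 0 < eps / (Rmax M 0 + 1)) by (apply Rdiv_lt_0_compat; [apply eps|exact HM]).
    generalize (filter_and _ _ H (Cnear_intro w _ _ Hd (fun v Hv => Hv))).
    apply filter_imp. intros v [H1 H2].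
    change (Cmod (f v - f w - (v - w) * l)%C <= eps * Cmod (v - w)%C).
    eapply Rle_trans; [exact H1|].
    pose proof (Cmod_ge_0 (v - w)%C) as Hp.
    apply Rmult_lt_compat_r with (r := Rmax M 0 + 1) in H2; [|exact HM].
    unfold Rdiv in H2. rewrite Rmult_assoc, Rinv_l, Rmult_1_r in H2 by lra.
    pose proof (Rmax_l M 0). nra.
Qed.

Lemma Cdiff_id (w : C) : Cdiff (fun v : C => v) w.
Proof. exists (RtoC 1). exact (@is_derive_id C_AbsRing w). Qed.

Lemma Cdiff_const (a w : C) : Cdiff (fun _ : C => a) w.
Proof. exists (RtoC 0). exact (@is_derive_const C_AbsRing CN a w). Qed.

Lemma Cdiff_plus (f g : C -> C) (w : C) :
  Cdiff f w -> Cdiff g w -> Cdiff (fun v => f v + g v)%C w.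
Proof. intros [l Hl] [m Hm]. eexists. exact (@is_derive_plus C_AbsRing CN f g w l m Hl Hm). Qed.

Lemma Cdiff_opp (f : C -> C) (w : C) : Cdiff f w -> Cdiff (fun v => - f v)%C w.
Proof. intros [l Hl]. eexists. exact (@is_derive_opp C_AbsRing CN f w l Hl). Qed.

Lemma Cdiff_minus (f g : C -> C) (w : C) :
  Cdiff f w -> Cdiff g w -> Cdiff (fun v => f v - g v)%C w.
Proof. intros Hf Hg. apply (Cdiff_plus f (fun v => - g v)%C w Hf), Cdiff_opp, Hg. Qed.

Lemma Cdiff_mult (f g : C -> C) (w : C) :
  Cdiff f w -> Cdiff g w -> Cdiff (fun v => f v * g v)%C w.
Proof.
  intros [l Hl] [m Hm]. eexists.
  exact (@is_derive_mult C_AbsRing f g w l m Hl Hm Cmult_comm).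
Qed.

Lemma Cdiff_comp (f g : C -> C) (w : C) :
  Cdiff f (g w) -> Cdiff g w -> Cdiff (fun v => f (g v)) w.
Proof. intros Hf Hg. exact (@ex_derive_comp C_AbsRing CN f g w Hf Hg). Qed.

Lemma Cdiff_ext_near (f g : C -> C) (w : C) :
  Cnear w (fun v => f v = g v) -> Cdiff f w -> Cdiff g w.
Proof. exact (@ex_derive_ext_loc C_AbsRing CN f g w). Qed.

Lemma Cdiff_near (f : C -> C) (w : C) (P : C -> Prop) :
  Cdiff f w -> Cnear (f w) P -> Cnear w (fun v => P (f v)).
Proof. intros Hf HP. exact (@ex_derive_continuous C_AbsRing CN f w Hf P HP). Qed.

Lemma Cmod_minus_ge (v w : C) : Cmod w - Cmod v <= Cmod (v - w)%C.
Proof.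
  assert (H : Cmod w <= Cmod v + Cmod (v - w)%C).
  { replace w with (v + - (v - w))%C at 1 by ring.
    eapply Rle_trans; [apply Cmod_triangle|]. rewrite Cmod_opp. lra. }
  lra.
Qed.

Lemma Cnear_Cmod_lt (w : C) (r : R) : Cmod w < r -> Cnear w (fun v : C => Cmod v < r).
Proof.
  intros H. apply Cnear_intro with (d := r - Cmod w); [lra|]. intros v Hv.
  replace v with (w + (v - w))%C by ring.
  eapply Rle_lt_trans; [apply Cmod_triangle|]. lra.
Qed.

Lemma Cnear_neq0 (w : C) : w <> RtoC 0 -> Cnear w (fun v : C => v <> RtoC 0).
Proof.
  intros H. apply Cmod_gt_0 in H. apply Cnear_intro with (d := Cmod w); [exact H|].
  intros v Hv ->. pose proof (Cmod_minus_ge (RtoC 0) w). rewrite Cmod_0 in *. lra.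
Qed.

Lemma Cdiff_Cinv (w : C) : w <> RtoC 0 -> Cdiff Cinv w.
Proof.
  intros Hw. assert (Hw' := proj1 (Cmod_gt_0 w) Hw).
  apply Cdiff_quadratic with (l := (- / (w * w))%C) (M := 2 / Cmod w ^ 3).
  (* Within this radius [|v| > |w| / 2], so the remainder [(v - w)^2 / (v w^2)] is bounded with the
     constant [2 / |w|^3]. *)
  apply Cnear_intro with (d := Cmod w / 2); [lra|]. intros v Hv.
  assert (Hvw : Cmod w / 2 < Cmod v) by (pose proof (Cmod_minus_ge v w); lra).
  assert (Hv0 : v <> RtoC 0) by (apply Cmod_gt_0; lra).
  replace (/ v - / w - (v - w) * - / (w * w))%C with ((v - w) * (v - w) / (v * (w * w)))%C
    by (field; auto).
  rewrite Cmod_div by (apply Cmult_neq_0; [exact Hv0|now apply Cmult_neq_0]).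
  rewrite !Cmod_mult.
  replace (2 / Cmod w ^ 3 * Cmod (v - w)%C ^ 2)
    with (Cmod (v - w)%C * Cmod (v - w)%C * (2 / Cmod w ^ 3)) by (field; lra).
  unfold Rdiv at 1. apply Rmult_le_compat_l; [apply Rmult_le_pos; apply Cmod_ge_0|].
  replace (2 / Cmod w ^ 3) with (/ (Cmod w / 2 * (Cmod w * Cmod w))) by (field; lra).
  apply Rinv_le_contravar; [apply Rmult_lt_0_compat; nra|].
  apply Rmult_le_compat_r; nra.
Qed.

Lemma Cdiff_div (f g : C -> C) (w : C) :
  Cdiff f w -> Cdiff g w -> g w <> RtoC 0 -> Cdiff (fun v => f v / g v)%C w.
Proof.
  intros Hf Hg H. apply (Cdiff_mult f (fun v => / g v)%C w Hf).
  apply (Cdiff_comp Cinv g w); [now apply Cdiff_Cinv|exact Hg].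
Qed.

(** * The principal square root on the plane cut along the nonpositive reals *)

Definition slit (w : C) : Prop := ~ (Im w = 0 /\ Re w <= 0).

Lemma Cmod_sqr (w : C) : Cmod w ^ 2 = Re w ^ 2 + Im w ^ 2.
Proof. apply Cmod2_alt. Qed.

(** Half-angle formulas: the two real square roots multiply to [|Im w| / 2], and the sign chosen in
    [csqrt] is that of [Im w]. *)
Lemma csqrt_sqr (w : C) : (csqrt w * csqrt w)%C = w.
Proof.
  pose proof (Cmod_sqr w) as Hm. pose proof (Cmod_ge_0 w) as H0.
  pose proof (re_le_Cmod w) as Hre. apply Rabs_le_between in Hre.
  unfold csqrt. destruct w as [a b]. unfold Re, Im in *. cbn [fst snd] in *.
  set (m := Cmod (a, b)) in *. clearbody m.
  assert (H1 := sqrt_sqrt ((m + a) / 2) ltac:(lra)).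
  assert (H2 := sqrt_sqrt ((m - a) / 2) ltac:(lra)).
  assert (H3 : sqrt ((m + a) / 2) * sqrt ((m - a) / 2) = Rabs b / 2).
  { rewrite <- sqrt_mult by lra.
    replace ((m + a) / 2 * ((m - a) / 2)) with (Rsqr (b / 2)) by (unfold Rsqr; nra).
    rewrite sqrt_Rsqr_abs, Rabs_div, (Rabs_right 2) by lra. reflexivity. }
  unfold Cmult; cbn [fst snd].
  destruct (Rle_dec 0 b) as [Hb|Hb].
  - rewrite Rabs_right in H3 by lra. f_equal; nra.
  - rewrite Rabs_left in H3 by lra. f_equal; nra.
Qed.

Lemma csqrt_Re_pos (w : C) : slit w -> 0 < Re (csqrt w).
Proof.
  intros Hw. unfold csqrt, Re at 1. cbn [fst].
  pose proof (Cmod_sqr w) as Hm. pose proof (Cmod_ge_0 w) as H0.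
  pose proof (re_le_Cmod w) as Hre. apply Rabs_le_between in Hre.
  apply sqrt_lt_R0.
  destruct (Rle_lt_dec (Cmod w + Re w) 0) as [H|H]; [|lra].
  exfalso. apply Hw. split; nra.
Qed.

Lemma csqrt_Re_nonneg (w : C) : 0 <= Re (csqrt w).
Proof. unfold csqrt, Re at 1. cbn [fst]. apply sqrt_pos. Qed.

Lemma slit_open (w : C) : slit w -> Cnear w slit.
Proof.
  intros Hw.
  destruct (Rle_lt_dec (Re w) 0) as [Hr|Hr].
  - assert (Hi : Im w <> 0) by (intros Hi; now apply Hw).
    apply Cnear_intro with (d := Rabs (Im w)); [now apply Rabs_pos_lt|].
    intros v Hv [Hv1 Hv2].
    assert (H : Rabs (Im (v - w)%C) <= Cmod (v - w)%C).
    { eapply Rle_trans; [|apply Rmax_Cmod]. apply Rmax_r. }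
    destruct v as [a b], w as [c d]. cbn in H, Hv1. unfold Im in Hv; cbn [snd] in Hv.
    subst b. rewrite Rplus_0_l, Rabs_Ropp in H. lra.
  - apply Cnear_intro with (d := Re w); [exact Hr|].
    intros v Hv [Hv1 Hv2].
    pose proof (re_le_Cmod (v - w)%C) as H. apply Rabs_le_between in H.
    destruct v as [a b], w as [c d]. cbn in H, Hv2, Hr, Hv. unfold Re in Hv; cbn [fst] in Hv.
    lra.
Qed.

(** With [s], [t] the roots of [v], [w], one has [v - w = (s - t)(s + t)] and the remainder is
    [-(s - t)^2 / (2 t)]. Since [Re s >= 0], [|s + t| >= Re t > 0], which bounds [|s - t|] by
    [|v - w| / Re t] for every [v]; the radius 1 is arbitrary. *)
Lemma Cdiff_csqrt (w : C) : slit w -> Cdiff csqrt w.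
Proof.
  intros Hw.
  set (t := csqrt w). assert (Ht : 0 < Re t) by now apply csqrt_Re_pos.
  assert (Ht0 : t <> RtoC 0) by (intros E; rewrite E in Ht; cbn in Ht; lra).
  assert (Hmt : 0 < Cmod t) by now apply Cmod_gt_0.
  apply Cdiff_quadratic with (l := (/ (2 * t))%C) (M := / (2 * Cmod t * Re t ^ 2)).
  apply Cnear_intro with (d := 1); [lra|]. intros v _. fold t.
  set (s := csqrt v).
  assert (Hs : (v - w)%C = ((s - t) * (s + t))%C).
  { unfold s, t. rewrite <- (csqrt_sqr v) at 1. rewrite <- (csqrt_sqr w) at 1. ring. }
  assert (H2 : (2 : C) <> RtoC 0) by (intros E; apply RtoC_inj in E; lra).
  assert (Hst : Re t <= Cmod (s + t)%C).
  { pose proof (re_le_Cmod (s + t)%C) as H. apply Rabs_le_between in H.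
    pose proof (csqrt_Re_nonneg v) as Hv. fold s in Hv.
    destruct s, t; cbn in *. lra. }
  replace (s - t - (v - w) * / (2 * t))%C with (- ((s - t) * (s - t) / (2 * t)))%C
    by (rewrite Hs; field; auto).
  rewrite Cmod_opp, Cmod_div by now apply Cmult_neq_0.
  rewrite Hs, !Cmod_mult, Cmod_R, (Rabs_right 2) by lra.
  set (a := Cmod (s - t)%C). set (b := Cmod (s + t)%C) in *.
  assert (Ha : 0 <= a) by apply Cmod_ge_0.
  replace (a * a / (2 * Cmod t)) with (/ (2 * Cmod t * Re t ^ 2) * (a * Re t) ^ 2) by (field; lra).
  apply Rmult_le_compat_l.
  - apply Rlt_le, Rinv_0_lt_compat. apply Rmult_lt_0_compat; nra.
  - apply pow_incr. split; [apply Rmult_le_pos; lra|]. apply Rmult_le_compat_l; lra.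
Qed.

(** * The root of smaller modulus *)

Lemma Cis0_spec (w : C) : Bool.reflect (w = RtoC 0) (Cis0 w).
Proof.
  unfold Cis0. destruct w as [a b]; unfold Re, Im; cbn [fst snd].
  destruct (Req_EM_T a 0) as [->|Ha]; [destruct (Req_EM_T b 0) as [->|Hb]|]; constructor.
  - reflexivity.
  - intros E. injection E. exact Hb.
  - intros E. injection E. intros _. exact Ha.
Qed.

Lemma C2_neq0 : RtoC 2 <> RtoC 0.
Proof. intros E; apply RtoC_inj in E; lra. Qed.

(** For a root [t], the other root [t'] satisfies [A t' = - (A t + B)], so the strict inequality
    says [|t| < |t'|]; it also makes sense for [A = 0]. *)
Lemma small_root_unique (A B D t : C) :
  A <> RtoC 0 -> (A * (t * t) + B * t + D)%C = RtoC 0 ->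
  Cmod (A * t)%C < Cmod (A * t + B)%C -> small_root A B D = t.
Proof.
  intros HA Ht Hlt. unfold small_root.
  destruct (Cis0_spec A) as [E|_]; [contradiction|]. cbv zeta.
  set (s := csqrt _).
  assert (H2 := C2_neq0).
  (* The discriminant is the square of [2 A t + B], so [s] equals this number up to sign. For either
     sign one of the two quotients is [t] and the other is the second root, of larger modulus. *)
  assert (Hs : (s * s)%C = ((2 * (A * t) + B) * (2 * (A * t) + B))%C).
  { unfold s. rewrite csqrt_sqr.
    replace (B * B - RtoC 4 * (A * D))%C
      with (B * B - RtoC 4 * A * (A * (t * t) + B * t + D) + RtoC 4 * A * (A * (t * t) + B * t))%C
      by ring.
    rewrite Ht. ring. }
  assert (Hz : ((s - (2 * (A * t) + B)) * (s + (2 * (A * t) + B)))%C = RtoC 0).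
  { replace ((s - (2 * (A * t) + B)) * (s + (2 * (A * t) + B)))%C
      with (s * s - (2 * (A * t) + B) * (2 * (A * t) + B))%C by ring.
    rewrite Hs. ring. }
  assert (HmA := proj1 (Cmod_gt_0 A) HA).
  assert (Hother : forall r, (A * r)%C = (- (A * t + B))%C -> Cmod t < Cmod r).
  { intros r Hr. assert (E : Cmod (A * r)%C = Cmod (A * t + B)%C) by now rewrite Hr, Cmod_opp.
    rewrite <- E, !Cmod_mult in Hlt. now apply Rmult_lt_reg_l in Hlt. }
  assert (Hs' : s = (2 * (A * t) + B)%C \/ s = (- (2 * (A * t) + B))%C).
  { destruct (Ceq_dec (s - (2 * (A * t) + B))%C (RtoC 0)) as [E|E].
    - left. now apply Ceq_minus.
    - right. destruct (Ceq_dec (s + (2 * (A * t) + B))%C (RtoC 0)) as [E'|E'].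
      + apply Ceq_minus. rewrite <- E'. ring.
      + exfalso. now apply (Cmult_neq_0 _ _ E E'). }
  destruct Hs' as [E|E]; rewrite E.
  - replace ((- B + (2 * (A * t) + B)) / (2 * A))%C with t by (field; auto).
    set (r := (_ / _)%C). assert (Hr : Cmod t < Cmod r) by (apply Hother; unfold r; field; auto).
    destruct Rle_dec; [reflexivity|lra].
  - replace ((- B - - (2 * (A * t) + B)) / (2 * A))%C with t by (field; auto).
    set (r := ((- B + - _) / _)%C).
    assert (Hr : Cmod t < Cmod r) by (apply Hother; unfold r; field; auto).
    destruct Rle_dec; [lra|reflexivity].
Qed.

(** For [A] nonzero the roots are [B (-1 + t) / (2 A)] and [B (-1 - t) / (2 A)] with
    [t^2 = 1 - 4 A D / B^2]. Their moduli agree exactly when [B = 0] or [t] is purely imaginary,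
    that is when [t^2 <= 0]. *)
Definition separated (A B D : C) : Prop :=
  B <> RtoC 0 /\ slit (1 - 4 * (A * D) / (B * B))%C.

(** The root of smaller modulus, written in a form that stays meaningful when [A = 0]. *)
Definition sroot (A B D : C) : C :=
  (- (2 * D / (B * (1 + csqrt (1 - 4 * (A * D) / (B * B))))))%C.

Lemma Cmod_1_minus_lt (t : C) : 0 < Re t -> Cmod (t - 1)%C < Cmod (t + 1)%C.
Proof.
  intros Ht. apply Rsqr_incrst_0; try apply Cmod_ge_0.
  rewrite !Rsqr_pow2, !Cmod_sqr. destruct t as [a b]. cbn in *. nra.
Qed.

Lemma Cplus1_neq0 (t : C) : 0 < Re t -> (1 + t)%C <> RtoC 0.
Proof. intros Ht E. apply (f_equal Re) in E. destruct t; cbn in *. lra. Qed.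

(** With [t] the square root of the normalized discriminant and [s] the root, [A s = B (t - 1) / 2]
    and [A s + B = B (t + 1) / 2]; the inequality is then [|t - 1| < |t + 1|], which is
    [Re t > 0]. *)
Lemma sroot_spec (A B D : C) : separated A B D ->
  (A * (sroot A B D * sroot A B D) + B * sroot A B D + D)%C = RtoC 0 /\
  Cmod (A * sroot A B D)%C < Cmod (A * sroot A B D + B)%C.
Proof.
  intros [HB Hd]. unfold sroot.
  assert (Ht := csqrt_Re_pos _ Hd). assert (Hsq := csqrt_sqr (1 - 4 * (A * D) / (B * B))%C).
  set (t := csqrt _) in *. assert (Ht1 := Cplus1_neq0 t Ht).
  assert (H2 := C2_neq0).
  assert (HAD : (2 * (2 * (A * D)))%C = (B * B * (1 - t * t))%C).
  { rewrite Hsq. replace (RtoC 4) with (RtoC 2 * RtoC 2)%C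
      by (rewrite <- RtoC_mult; f_equal; lra). field; auto. }
  assert (HAs : (A * - (2 * D / (B * (1 + t))))%C = (B * (t - 1) / 2)%C).
  { transitivity (- (2 * (2 * (A * D)) / (2 * B * (1 + t))))%C; [field; auto|].
    rewrite HAD. field; auto. }
  split.
  - rewrite Cmult_assoc, HAs. field; auto.
  - rewrite HAs. replace (B * (t - 1) / 2 + B)%C with (B * (t + 1) / 2)%C by (field; auto).
    unfold Cdiv. rewrite !Cmod_mult.
    apply Rmult_lt_compat_r; [rewrite Cmod_inv by exact H2; now apply Rinv_0_lt_compat, Cmod_gt_0|].
    apply Rmult_lt_compat_l; [now apply Cmod_gt_0|]. now apply Cmod_1_minus_lt.
Qed.

(** For [A = 0] the normalized discriminant is 1 with root 1, and [sroot] becomes [- D / B], the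
    value assigned by [small_root]. *)
Lemma small_root_sroot (A B D : C) : separated A B D -> small_root A B D = sroot A B D.
Proof.
  intros H. destruct (Ceq_dec A (RtoC 0)) as [->|HA].
  - destruct H as [HB _]. unfold small_root, sroot.
    destruct (Cis0_spec (RtoC 0)) as [_|E]; [|now contradiction E].
    destruct (Cis0_spec B) as [E|_]; [contradiction|].
    assert (E : csqrt (1 - 4 * (0 * D) / (B * B))%C = RtoC 1).
    { replace (1 - 4 * (0 * D) / (B * B))%C with (RtoC 1) by (field; auto).
      unfold csqrt. rewrite Cmod_1. cbn. destruct Rle_dec; [|lra].
      replace ((1 + 1) / 2) with 1 by lra. replace ((1 - 1) / 2) with 0 by lra.
      now rewrite sqrt_1, sqrt_0. }
    rewrite E. rewrite <- RtoC_plus. replace (1 + 1) with 2 by lra.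
    field. exact HB.
  - destruct (sroot_spec A B D H) as [H1 H2]. now apply small_root_unique.
Qed.

Lemma small_root_spec (A B D : C) : separated A B D ->
  (A * (small_root A B D * small_root A B D) + B * small_root A B D + D)%C = RtoC 0.
Proof. intros H. rewrite small_root_sroot by exact H. now apply sroot_spec. Qed.

(** By Vieta [D = - (A s + B) s], and [|A s| < |A s + B|] is multiplied by [|s|]; [D <> 0] gives
    [s <> 0], which keeps the inequality strict. *)
Lemma small_root_lt (A B D : C) : separated A B D -> D <> RtoC 0 ->
  Cmod A * Cmod (small_root A B D) ^ 2 < Cmod D.
Proof.
  intros H HD. rewrite small_root_sroot by exact H.
  destruct (sroot_spec A B D H) as [H1 H2]. set (s := sroot A B D) in *.
  assert (Hs : s <> RtoC 0).
  { intros E. apply HD. rewrite <- H1, E. ring. }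
  apply Cmod_gt_0 in Hs.
  assert (E : D = (- ((A * s + B) * s))%C).
  { apply Ceq_minus. rewrite <- H1. ring. }
  rewrite E, Cmod_opp, (Cmod_mult _ s).
  replace (Cmod A * Cmod s ^ 2) with (Cmod (A * s)%C * Cmod s) by (rewrite Cmod_mult; ring).
  now apply Rmult_lt_compat_r.
Qed.

(** [separated] is an open condition, so near [w] the case distinctions of [small_root] can be
    replaced by the single formula [sroot]. The openness itself is needed again for the gluing. *)
Lemma Cdiff_small_root (A B D : C -> C) (w : C) :
  Cdiff A w -> Cdiff B w -> Cdiff D w -> separated (A w) (B w) (D w) ->
  Cdiff (fun v => small_root (A v) (B v) (D v)) w /\
  Cnear w (fun v => separated (A v) (B v) (D v)).
Proof.
  intros HA HB HD [HB0 Hs].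
  assert (Hdisc : Cdiff (fun v => 1 - 4 * (A v * D v) / (B v * B v))%C w).
  { apply Cdiff_minus; [apply Cdiff_const|]. apply Cdiff_div.
    - apply (Cdiff_mult (fun _ => RtoC 4) (fun v => A v * D v)%C);
        [apply Cdiff_const|now apply Cdiff_mult].
    - now apply Cdiff_mult.
    - now apply Cmult_neq_0. }
  assert (Hnear : Cnear w (fun v => separated (A v) (B v) (D v))).
  { apply filter_and.
    - apply (Cdiff_near B w (fun u => u <> RtoC 0) HB). now apply Cnear_neq0.
    - apply (Cdiff_near _ w slit Hdisc). now apply slit_open. }
  split; [|exact Hnear].
  apply (Cdiff_ext_near (fun v => sroot (A v) (B v) (D v))).
  - revert Hnear. apply filter_imp. intros v Hv. now rewrite small_root_sroot.
  - unfold sroot. apply Cdiff_opp, Cdiff_div.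
    + apply (Cdiff_mult (fun _ => RtoC 2) D); [apply Cdiff_const|exact HD].
    + apply Cdiff_mult; [exact HB|]. apply (Cdiff_plus (fun _ => RtoC 1)); [apply Cdiff_const|].
      apply (Cdiff_comp csqrt _ w); [now apply Cdiff_csqrt|exact Hdisc].
    + apply Cmult_neq_0; [exact HB0|]. now apply Cplus1_neq0, csqrt_Re_pos.
Qed.

(** * The cuts *)

(** The equation says [w + 1/w = 2 m]. A nonreal [w] would have real part [m], and the real part of
    the equation would give [m^2 + (Im w)^2 = 1], against [m > 1]. *)
Lemma reciprocal_roots_real (w : C) (m : R) : 1 < m ->
  (w * w - 2 * m * w + 1)%C = RtoC 0 ->
  Im w = 0 /\ 0 < Re w /\ Re w * Re w + 1 = 2 * m * Re w.
Proof.
  intros Hm E. destruct w as [a b].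
  assert (E1 := f_equal Re E). assert (E2 := f_equal Im E).
  unfold Re, Im in *. cbn in *.
  assert (Hb : b = 0).
  { destruct (Req_dec b 0) as [H|H]; [exact H|exfalso].
    assert (a = m) by (apply (Rmult_eq_reg_r b); lra). nra. }
  subst b. split; [reflexivity|]. split; nra.
Qed.

Lemma not_slit (u : C) : ~ slit u -> exists r : R, r <= 0 /\ u = RtoC r.
Proof.
  intros H. destruct u as [a b].
  destruct (Req_dec b 0) as [Hb|Hb].
  - destruct (Rle_lt_dec a 0) as [Ha|Ha].
    + exists a. split; [exact Ha|]. now subst b.
    + exfalso. apply H. intros [_ H']. cbn in H'. lra.
  - exfalso. apply H. intros [H' _]. now apply Hb.
Qed.

Lemma slit_dec (u : C) : slit u \/ ~ slit u.
Proof.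
  unfold slit. destruct (Req_dec (Im u) 0), (Rle_lt_dec (Re u) 0); [right|left|left|left]; intuition lra.
Qed.

Lemma RtoC_neq0 (r : R) : r <> 0 -> RtoC r <> RtoC 0.
Proof. intros H E. now apply H, RtoC_inj. Qed.

Lemma sqrt_sep (b c : R) (hc : 0 <= c) (t : R) (ht : (t - b) ^ 2 >= c) :
  t <= b - sqrt c \/ b + sqrt c <= t.
Proof.
  pose proof (sqrt_sqrt c hc). pose proof (sqrt_pos c).
  destruct (Rle_lt_dec t (b - sqrt c)); [now left|right].
  destruct (Rle_lt_dec (b + sqrt c) t); [assumption|exfalso]. nra.
Qed.

Lemma sqrt_between (b c : R) (hc : 0 <= c) (t : R) (ht : (t - b) ^ 2 <= c) :
  b - sqrt c <= t <= b + sqrt c.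
Proof. pose proof (sqrt_sqrt c hc). pose proof (sqrt_pos c). split; nra. Qed.

Section Branches.
Context (z : R) (hz : 0 < z < 1 / 4).

Definition XA (y : C) : C := (z * (y * (y + 1)))%C.
Definition XD (y : C) : C := (z * (y + 1))%C.
Definition YA (x : C) : C := (z * (x * x))%C.
Definition YB (x : C) : C := (z * (x * x) - x + z)%C.

(** If the normalized discriminant [1 - 4 z^2 (y + 1)^2 / y] were a real [r <= 0], then [y + 1/y]
    would be real and larger than 2 because [z < 1/4]. So [y] would be real and positive with
    [4 z^2 (y + 1)^2 >= y], which describes the cuts. *)
Lemma X_separated (y : C) :
  ~ on_seg (y1 z) (y2 z) y -> ~ on_ray (y3 z) y -> separated (XA y) (- y)%C (XD y).
Proof.
  intros H1 H2. unfold on_seg, on_ray, y1, y2, y3 in *.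
  assert (Hz2 : 0 < z ^ 2 < 1 / 16) by (split; nra).
  assert (Hs := sqrt_sqrt (1 - 16 * z ^ 2) ltac:(nra)).
  assert (Hs0 := sqrt_pos (1 - 16 * z ^ 2)).
  set (s := sqrt (1 - 16 * z ^ 2)) in *.
  assert (Hy2 : 0 <= (1 - 8 * z ^ 2 - s) / (8 * z ^ 2)).
  { apply Rmult_le_pos; [nra|]. apply Rlt_le, Rinv_0_lt_compat. lra. }
  assert (Hy : y <> RtoC 0).
  { intros ->. apply H1. cbn. split; [reflexivity|]. split; [lra|exact Hy2]. }
  split.
  - intros E. apply Hy. replace y with (- - y)%C by ring. rewrite E. ring.
  - destruct (slit_dec (1 - 4 * (XA y * XD y) / (- y * - y))%C) as [H|H]; [exact H|exfalso].
    apply not_slit in H. destruct H as [r [Hr E]].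
    assert (E1 : (4 * z * z * ((y + 1) * (y + 1)))%C = ((1 - r) * y)%C).
    { rewrite <- E. unfold XA, XD. field. exact Hy. }
    (* Chosen so that [4 z^2 (y + 1)^2 = (1 - r) y] reads [y^2 - 2 m y + 1 = 0]. *)
    set (m := (1 - r) / (8 * z ^ 2) - 1).
    assert (Hmr : 8 * z ^ 2 * (m + 1) = 1 - r) by (unfold m; field; lra).
    assert (Hm : 1 < m) by nra.
    destruct (reciprocal_roots_real y m Hm) as [Hi [Hp Hq]].
    { assert (Hzz : (4 * z * z)%C <> RtoC 0).
      { rewrite <- !RtoC_mult. apply RtoC_neq0. nra. }
      assert (E2 : (4 * z * z * (y * y - 2 * m * y + 1))%C = RtoC 0).
      { transitivity (4 * z * z * ((y + 1) * (y + 1)) - RtoC (8 * z ^ 2 * (m + 1)) * y)%C.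
        - replace (8 * z ^ 2 * (m + 1)) with (4 * z * z * (2 * m + 2)) by ring.
          rewrite !RtoC_mult, RtoC_plus, RtoC_mult. ring.
        - rewrite E1, Hmr, RtoC_minus. ring. }
      destruct (Ceq_dec (y * y - 2 * m * y + 1)%C (RtoC 0)) as [E3|E3]; [exact E3|].
      now destruct (Cmult_neq_0 _ _ Hzz E3). }
    set (a := Re y) in *.
    (* Completing the square turns [4 z^2 (a + 1)^2 >= a] into
       [(8 z^2 a - (1 - 8 z^2))^2 >= 1 - 16 z^2]. *)
    destruct (sqrt_sep (1 - 8 * z ^ 2) (1 - 16 * z ^ 2) ltac:(nra) (8 * z ^ 2 * a)) as [Ha|Ha].
    + assert (4 * z ^ 2 * (a * a + 1 + 2 * a) >= a); nra.
    + apply H1. split; [exact Hi|]. split; [lra|].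
      apply Rmult_le_reg_r with (8 * z ^ 2); [lra|].
      replace ((1 - 8 * z ^ 2 - s) / (8 * z ^ 2) * (8 * z ^ 2)) with (1 - 8 * z ^ 2 - s) by (field; lra).
      unfold s. lra.
    + apply H2. split; [exact Hi|].
      apply Rmult_le_reg_r with (8 * z ^ 2); [lra|].
      replace ((1 - 8 * z ^ 2 + s) / (8 * z ^ 2) * (8 * z ^ 2)) with (1 - 8 * z ^ 2 + s) by (field; lra).
      unfold s. lra.
Qed.

(** A normalized discriminant [r <= 0] means [(1 - r) YB^2 = 4 z^2 x^2], which factors as
    [YB = z v x] or [YB = - z v x] with [v = 2 / sqrt (1 - r)]. Then [x + 1/x] lies between
    [1/z - 2], its value at [x2] and [x3], and [1/z + 2], its value at [x1] and [x4]. *)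
Lemma Y_separated (x : C) :
  ~ on_seg (x1 z) (x2 z) x -> ~ on_seg (x3 z) (x4 z) x -> separated (YA x) (YB x) z.
Proof.
  intros H1 H2.
  assert (Hz : RtoC z <> RtoC 0) by (apply RtoC_neq0; lra).
  (* On the excluded set, [YB x = z v x] with [v] real and [|v| <= 2]. *)
  assert (key : forall v : R, -2 <= v <= 2 -> YB x = (z * v * x)%C -> False).
  { intros v Hv E. unfold on_seg, x1, x2, x3, x4 in *.
    set (m := (/ z + v) / 2).
    assert (Hzm : 2 * z * m = 1 + z * v) by (unfold m; field; lra).
    assert (Hzv : - 2 * z <= z * v <= 2 * z) by nra.
    assert (Hm : 1 < m) by (apply Rmult_lt_reg_l with (2 * z); lra).
    destruct (reciprocal_roots_real x m Hm) as [Hi [Hp Hq]].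
    { assert (E2 : (z * (x * x - 2 * m * x + 1))%C = RtoC 0).
      { transitivity (YB x + x - RtoC (2 * z * m) * x)%C.
        - rewrite !RtoC_mult. unfold YB. ring.
        - rewrite Hzm, E, RtoC_plus, RtoC_mult. ring. }
      destruct (Ceq_dec (x * x - 2 * m * x + 1)%C (RtoC 0)) as [E3|E3]; [exact E3|].
      now destruct (Cmult_neq_0 _ _ Hz E3). }
    set (a := Re x) in *.
    assert (Ha : z * (a * a + 1) = (1 + z * v) * a) by nra.
    (* [Ho] places [a] between [x1] and [x4], and [Hin] outside the open interval from [x2] to
       [x3]. *)
    assert (Ho : (2 * z * a - (1 + 2 * z)) ^ 2 <= 1 + 4 * z) by nra.
    assert (Hin : (2 * z * a - (1 - 2 * z)) ^ 2 >= 1 - 4 * z) by nra.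
    apply sqrt_between in Ho; [|lra]. apply sqrt_sep in Hin; [|lra].
    assert (Hdiv : forall t, t / (2 * z) * (2 * z) = t) by (intros; field; lra).
    destruct Hin as [Hin|Hin]; [apply H1|apply H2]; split; try exact Hi; split;
      apply Rmult_le_reg_r with (2 * z); rewrite ?Hdiv; lra. }
  assert (HB : YB x <> RtoC 0).
  { intros E. apply (key 0); [lra|]. rewrite E. ring. }
  split; [exact HB|].
  destruct (slit_dec (1 - 4 * (YA x * z) / (YB x * YB x))%C) as [H|H]; [exact H|exfalso].
  apply not_slit in H. destruct H as [r [Hr E]].
  set (v := 2 / sqrt (1 - r)).
  assert (Hs := sqrt_sqrt (1 - r) ltac:(lra)).
  assert (Hs1 : 1 <= sqrt (1 - r)) by (rewrite <- sqrt_1 at 1; apply sqrt_le_1; lra).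
  assert (Hv : 0 <= v <= 2).
  { unfold v. split.
    - apply Rlt_le, Rdiv_lt_0_compat; lra.
    - apply Rmult_le_reg_r with (sqrt (1 - r)); [lra|].
      replace (2 / sqrt (1 - r) * sqrt (1 - r)) with 2 by (field; lra). lra. }
  assert (Hvr : v * v * (1 - r) = 4).
  { rewrite <- Hs. unfold v. field. lra. }
  assert (E1 : ((1 - r) * (YB x * YB x))%C = (4 * (YA x * z))%C).
  { rewrite <- E. field. exact HB. }
  assert (Hr1 : (1 - r)%C <> RtoC 0).
  { rewrite <- RtoC_minus. apply RtoC_neq0. lra. }
  assert (E2 : ((YB x - z * v * x) * (YB x - z * RtoC (- v) * x))%C = RtoC 0).
  { assert (E3 : ((1 - r) * ((YB x - z * v * x) * (YB x - z * RtoC (- v) * x)))%C = RtoC 0).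
    { rewrite RtoC_opp.
      transitivity ((1 - r) * (YB x * YB x) - RtoC (v * v * (1 - r)) * (z * z * (x * x)))%C.
      - rewrite !RtoC_mult, RtoC_minus. ring.
      - rewrite E1, Hvr. unfold YA. ring. }
    destruct (Ceq_dec ((YB x - z * v * x) * (YB x - z * RtoC (- v) * x))%C (RtoC 0)) as [E4|E4];
      [exact E4|]. now destruct (Cmult_neq_0 _ _ Hr1 E4). }
  destruct (Ceq_dec (YB x - z * v * x)%C (RtoC 0)) as [E3|E3].
  - apply (key v); [lra|]. now apply Ceq_minus.
  - destruct (Ceq_dec (YB x - z * RtoC (- v) * x)%C (RtoC 0)) as [E4|E4].
    + apply (key (- v)); [lra|]. now apply Ceq_minus.
    + now apply (Cmult_neq_0 _ _ E3 E4).
Qed.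

End Branches.

(** * The generating function *)

Definition wmass (k : nat) : R :=
  sum_f_R0 (fun i => sum_f_R0 (fun j => INR (q i j k)) k) k.

Lemma sum_f_R0_ge_first (f : nat -> R) (n : nat) :
  (forall i, 0 <= f i) -> f 0%nat <= sum_f_R0 f n.
Proof. intros H. induction n as [|n IH]; cbn [sum_f_R0]; [lra|]. specialize (H (S n)). lra. Qed.

Lemma wpoly_1_1 (k : nat) : wpoly k 1 1 = RtoC (wmass k).
Proof.
  unfold wpoly, wpoly_upto, wmass. rewrite <- csum_RtoC. apply csum_ext. intros i _.
  rewrite Cpow_1_l, Cmult_1_r, <- csum_RtoC. apply csum_ext. intros j _.
  rewrite Cpow_1_l, Cmult_1_r. reflexivity.
Qed.

(** This is [wpoly_S] at [x = y = 1]: the added term [q 0 0 k] is outweighed by the subtracted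
    boundary sums. *)
Lemma wmass_S (k : nat) : wmass (S k) <= 4 * wmass k.
Proof.
  assert (E := wpoly_S k 1 1). rewrite !Cmult_1_l, !wpoly_1_1 in E.
  rewrite !wpoly_x_0, wpoly_0_y in E.
  set (a := sum_f_R0 (fun j => INR (q 0 j k)) k).
  set (b := sum_f_R0 (fun i => INR (q i 0 k)) k).
  assert (Ea : csum (fun j => qC 0 j k * 1 ^ j)%C k = RtoC a).
  { unfold a. rewrite <- csum_RtoC. apply csum_ext. intros j _.
    rewrite Cpow_1_l, Cmult_1_r. reflexivity. }
  assert (Eb : csum (fun i => qC i 0 k * 1 ^ i)%C k = RtoC b).
  { unfold b. rewrite <- csum_RtoC. apply csum_ext. intros j _.
    rewrite Cpow_1_l, Cmult_1_r. reflexivity. }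
  rewrite Ea, Eb, csum_at_0 in E. unfold qC in E.
  rewrite <- ?RtoC_plus, <- ?RtoC_mult, <- ?RtoC_minus, <- ?RtoC_plus, <- ?RtoC_mult, <- ?RtoC_minus, <- ?RtoC_plus in E.
  apply RtoC_inj in E.
  assert (Ha : 0 <= a) by (apply cond_pos_sum; intros; apply pos_INR).
  assert (Hb : INR (q 0 0 k) <= b).
  { apply (sum_f_R0_ge_first (fun i => INR (q i 0 k))). intros; apply pos_INR. }
  lra.
Qed.

Lemma wmass_le (k : nat) : wmass k <= 4 ^ k.
Proof.
  induction k as [|k IH].
  - unfold wmass. cbn [sum_f_R0]. rewrite q_0. cbn. lra.
  - pose proof (wmass_S k). cbn [pow]. lra.
Qed.

Lemma Cmod_qC (i j k : nat) : Cmod (qC i j k) = INR (q i j k).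
Proof. unfold qC. rewrite Cmod_R. apply Rabs_right, Rle_ge, pos_INR. Qed.

Lemma pow_le_1 (r : R) (n : nat) : 0 <= r <= 1 -> r ^ n <= 1.
Proof. intros H. rewrite <- (pow1 n). now apply pow_incr. Qed.

Lemma wpoly_row_le (k i : nat) (y : C) : Cmod y <= 1 ->
  Cmod (csum (fun j => qC i j k * y ^ j)%C k) <= sum_f_R0 (fun j => INR (q i j k)) k.
Proof.
  intros Hy. eapply Rle_trans; [apply Cmod_csum|]. apply sum_Rle. intros j _.
  rewrite Cmod_mult, Cmod_qC, Cmod_pow.
  pose proof (pow_le_1 (Cmod y) j (conj (Cmod_ge_0 y) Hy)).
  pose proof (pos_INR (q i j k)). nra.
Qed.

Lemma wpoly_le (k : nat) (x y : C) : Cmod x <= 1 -> Cmod y <= 1 ->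
  Cmod (wpoly k x y) <= 4 ^ k.
Proof.
  intros Hx Hy. eapply Rle_trans; [|apply wmass_le].
  eapply Rle_trans; [apply Cmod_csum|]. apply sum_Rle. intros i _.
  rewrite Cmod_mult, Cmod_pow.
  pose proof (pow_le_1 (Cmod x) i (conj (Cmod_ge_0 x) Hx)).
  pose proof (wpoly_row_le k i y Hy).
  pose proof (Cmod_ge_0 (csum (fun j => qC i j k * y ^ j)%C k)). nra.
Qed.

(** * Quadratic remainder bounds for powers and polynomials in the unit disc *)

Fixpoint Cpow_deriv (x : C) (n : nat) : C :=
  match n with
  | O => RtoC 0
  | S m => (x * Cpow_deriv x m + x ^ m)%C
  end.

Lemma Cpow_deriv_le (x : C) (n : nat) : Cmod x <= 1 -> Cmod (Cpow_deriv x n) <= INR n.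
Proof.
  intros Hx. induction n as [|n IH]; cbn [Cpow_deriv].
  - rewrite Cmod_0. apply Rle_refl.
  - eapply Rle_trans; [apply Cmod_triangle|]. rewrite Cmod_mult, Cmod_pow, S_INR.
    pose proof (pow_le_1 (Cmod x) n (conj (Cmod_ge_0 x) Hx)).
    pose proof (Cmod_ge_0 (Cpow_deriv x n)). pose proof (Cmod_ge_0 x). nra.
Qed.

(** By the product-rule form of [Cpow_deriv], the remainder of degree [n + 1] is [v] times that of
    degree [n] plus [(v - x)^2] times a factor of modulus at most [n], and
    [n^2 + n <= (n + 1)^2]. *)
Lemma Cpow_quadratic (v x : C) (n : nat) : Cmod v <= 1 -> Cmod x <= 1 ->
  Cmod (v ^ n - x ^ n - (v - x) * Cpow_deriv x n)%C <= INR n ^ 2 * Cmod (v - x)%C ^ 2.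
Proof.
  intros Hv Hx. induction n as [|n IH].
  - cbn [Cpow Cpow_deriv].
    replace (1 - 1 - (v - x) * 0)%C with (RtoC 0) by ring. rewrite Cmod_0. cbn. lra.
  - cbn [Cpow_deriv]. rewrite !Cpow_S.
    replace (v * v ^ n - x * x ^ n - (v - x) * (x * Cpow_deriv x n + x ^ n))%C
      with (v * (v ^ n - x ^ n - (v - x) * Cpow_deriv x n)
            + Cpow_deriv x n * ((v - x) * (v - x)))%C by ring.
    eapply Rle_trans; [apply Cmod_triangle|]. rewrite !Cmod_mult, S_INR.
    pose proof (Cpow_deriv_le x n Hx). pose proof (pos_INR n).
    set (h := Cmod (v - x)%C) in *. assert (Hh : 0 <= h * h) by apply Rle_0_sqr.
    set (e := Cmod (v ^ n - x ^ n - (v - x) * Cpow_deriv x n)%C) in *.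
    assert (He : 0 <= e) by apply Cmod_ge_0.
    assert (Cmod v * e <= e) by nra.
    assert (Cmod (Cpow_deriv x n) * (h * h) <= INR n * (h * h)) by nra.
    nra.
Qed.

Lemma csum_Cpow_quadratic (c : nat -> C) (n : nat) (v x : C) (M : R) :
  Cmod v <= 1 -> Cmod x <= 1 -> sum_f_R0 (fun i => Cmod (c i)) n <= M ->
  Cmod (csum (fun i => c i * v ^ i) n - csum (fun i => c i * x ^ i) n
        - (v - x) * csum (fun i => c i * Cpow_deriv x i) n)%C
  <= INR n ^ 2 * M * Cmod (v - x)%C ^ 2.
Proof.
  intros Hv Hx HM.
  replace (csum (fun i => c i * v ^ i) n - csum (fun i => c i * x ^ i) n
        - (v - x) * csum (fun i => c i * Cpow_deriv x i) n)%C
    with (csum (fun i => c i * (v ^ i - x ^ i - (v - x) * Cpow_deriv x i)) n)%C.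
  2: { clear HM. induction n as [|n IH]; rewrite ?csum_0, ?csum_S; [ring|]. rewrite IH. ring. }
  eapply Rle_trans; [apply Cmod_csum|].
  eapply Rle_trans.
  - apply sum_Rle with (Bn := fun i => Cmod (c i) * (INR n ^ 2 * Cmod (v - x)%C ^ 2)).
    intros i Hi. rewrite Cmod_mult. apply Rmult_le_compat_l; [apply Cmod_ge_0|].
    eapply Rle_trans; [now apply Cpow_quadratic|].
    apply Rmult_le_compat_r; [apply pow2_ge_0|].
    apply pow_incr. split; [apply pos_INR|now apply le_INR].
  - rewrite <- scal_sum.
    pose proof (pow2_ge_0 (Cmod (v - x)%C)). pose proof (pow2_ge_0 (INR n)).
    assert (0 <= INR n ^ 2 * Cmod (v - x)%C ^ 2) by now apply Rmult_le_pos.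
    nra.
Qed.

(** * Absolutely convergent complex series and termwise differentiation *)

Definition CSeries (a : nat -> C) : C :=
  (Series (fun k => Re (a k)), Series (fun k => Im (a k))).

Definition Csummable (a : nat -> C) : Prop := ex_series (fun k => Cmod (a k)).

Lemma Im_le_Cmod (w : C) : Rabs (Im w) <= Cmod w.
Proof. eapply Rle_trans; [|apply Rmax_Cmod]. apply Rmax_r. Qed.

Lemma Csummable_Re (a : nat -> C) : Csummable a -> ex_series (fun k => Rabs (Re (a k))).
Proof.
  apply (@ex_series_le R_AbsRing R_CompleteNormedModule). intros k.
  change (Rabs (Rabs (Re (a k))) <= Cmod (a k)). rewrite Rabs_Rabsolu. apply re_le_Cmod.
Qed.

Lemma Csummable_Im (a : nat -> C) : Csummable a -> ex_series (fun k => Rabs (Im (a k))).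
Proof.
  apply (@ex_series_le R_AbsRing R_CompleteNormedModule). intros k.
  change (Rabs (Rabs (Im (a k))) <= Cmod (a k)). rewrite Rabs_Rabsolu. apply Im_le_Cmod.
Qed.

Lemma Csummable_le (a : nat -> C) (M : nat -> R) :
  (forall k, Cmod (a k) <= M k) -> ex_series M -> Csummable a.
Proof.
  intros H. apply (@ex_series_le R_AbsRing R_CompleteNormedModule). intros k.
  change (Rabs (Cmod (a k)) <= M k). rewrite Rabs_right; [apply H|apply Rle_ge, Cmod_ge_0].
Qed.

Lemma Csummable_plus (a b : nat -> C) :
  Csummable a -> Csummable b -> Csummable (fun k => a k + b k)%C.
Proof.
  intros Ha Hb. apply (Csummable_le _ (fun k => Cmod (a k) + Cmod (b k))).
  - intros k. apply Cmod_triangle.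
  - exact (ex_series_plus _ _ Ha Hb).
Qed.

Lemma Csummable_scal (c : C) (a : nat -> C) :
  Csummable a -> Csummable (fun k => c * a k)%C.
Proof.
  intros Ha. apply (Csummable_le _ (fun k => Cmod c * Cmod (a k))).
  - intros k. rewrite Cmod_mult. apply Rle_refl.
  - exact (ex_series_scal_l (Cmod c) _ Ha).
Qed.

Lemma CSeries_ext (a b : nat -> C) : (forall k, a k = b k) -> CSeries a = CSeries b.
Proof. intros H. unfold CSeries. f_equal; apply Series_ext; intros k; now rewrite H. Qed.

Lemma CSeries_plus (a b : nat -> C) : Csummable a -> Csummable b ->
  CSeries (fun k => a k + b k)%C = (CSeries a + CSeries b)%C.
Proof.
  intros Ha Hb. unfold CSeries, Cplus at 3. cbn [fst snd].
  f_equal; rewrite <- Series_plus; try reflexivity;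
    apply ex_series_Rabs; auto using Csummable_Re, Csummable_Im.
Qed.

Lemma CSeries_scal (c : C) (a : nat -> C) : Csummable a ->
  CSeries (fun k => c * a k)%C = (c * CSeries a)%C.
Proof.
  intros Ha. assert (H1 := ex_series_Rabs _ (Csummable_Re a Ha)).
  assert (H2 := ex_series_Rabs _ (Csummable_Im a Ha)).
  unfold CSeries, Cmult at 3. cbn [fst snd].
  f_equal; rewrite <- !Series_scal_l.
  - rewrite <- Series_minus; [reflexivity|..];
      [exact (ex_series_scal_l (fst c) _ H1)|exact (ex_series_scal_l (snd c) _ H2)].
  - rewrite <- Series_plus; [reflexivity|..];
      [exact (ex_series_scal_l (fst c) _ H2)|exact (ex_series_scal_l (snd c) _ H1)].
Qed.

Lemma CSeries_incr (a : nat -> C) : Csummable a ->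
  CSeries a = (a 0%nat + CSeries (fun k => a (S k)))%C.
Proof.
  intros Ha. unfold CSeries, Cplus at 1. cbn [fst snd].
  f_equal; rewrite Series_incr_1; try reflexivity;
    apply ex_series_Rabs; auto using Csummable_Re, Csummable_Im.
Qed.

(** The factor 2 comes from bounding the real and imaginary parts separately. *)
Lemma Cmod_CSeries (a : nat -> C) (M : nat -> R) :
  (forall k, Cmod (a k) <= M k) -> ex_series M -> Cmod (CSeries a) <= 2 * Series M.
Proof.
  intros H HM. assert (Ha := Csummable_le a M H HM).
  assert (H1 : Rabs (Re (CSeries a)) <= Series M).
  { eapply Rle_trans; [apply Series_Rabs, Csummable_Re, Ha|].
    apply Series_le; [|exact HM]. intros k. split; [apply Rabs_pos|].
    eapply Rle_trans; [apply re_le_Cmod|apply H]. }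
  assert (H2 : Rabs (Im (CSeries a)) <= Series M).
  { eapply Rle_trans; [apply Series_Rabs, Csummable_Im, Ha|].
    apply Series_le; [|exact HM]. intros k. split; [apply Rabs_pos|].
    eapply Rle_trans; [apply Im_le_Cmod|apply H]. }
  assert (Hs := Cmod_sqr (CSeries a)). assert (H0 := Cmod_ge_0 (CSeries a)).
  rewrite <- (pow2_abs (Re _)), <- (pow2_abs (Im _)) in Hs.
  assert (H3 := Rabs_pos (Re (CSeries a))). assert (H4 := Rabs_pos (Im (CSeries a))).
  nra.
Qed.

(** Quadratic remainders with summable constants add up to a quadratic remainder for the sum, so
    [Cdiff_quadratic] applies. *)
Lemma CSeries_Cdiff (u : nat -> C -> C) (D : nat -> C) (M : nat -> R) (w : C) :
  Cnear w (fun v : C => forall k, Csummable (fun k => u k v) /\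
    Cmod (u k v - u k w - (v - w) * D k)%C <= M k * Cmod (v - w)%C ^ 2) ->
  Csummable D -> ex_series M ->
  Cdiff (fun v => CSeries (fun k => u k v)) w.
Proof.
  intros Hu HD HM.
  assert (Hw : Csummable (fun k => u k w)).
  { exact (proj1 (@locally_singleton CU w _ Hu 0%nat)). }
  apply Cdiff_quadratic with (l := CSeries D) (M := 2 * Series M).
  revert Hu. apply filter_imp. intros v Hv.
  assert (Hsv : Csummable (fun k => u k v)) by exact (proj1 (Hv 0%nat)).
  assert (E : (CSeries (fun k => u k v) - CSeries (fun k => u k w) - (v - w) * CSeries D)%C
    = CSeries (fun k => u k v + ((- (1)) * u k w + (- (v - w)) * D k))%C).
  { rewrite CSeries_plus, CSeries_plus, !CSeries_scal;
      auto using Csummable_plus, Csummable_scal. ring. }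
  rewrite E. clear E.
  replace (2 * Series M * Cmod (v - w)%C ^ 2)
    with (2 * Series (fun k => M k * Cmod (v - w)%C ^ 2)) by (rewrite Series_scal_r; ring).
  apply Cmod_CSeries.
  - intros k.
    replace (u k v + (- (1) * u k w + - (v - w) * D k))%C
      with (u k v - u k w - (v - w) * D k)%C by ring.
    apply Hv.
  - exact (ex_series_scal_r (Cmod (v - w)%C ^ 2) _ HM).
Qed.

(** Ratio test; the shift to [S k] keeps every term nonzero, as the test requires. *)
Lemma ex_series_sqr_geom (r : R) : 0 < r < 1 -> ex_series (fun k => INR (S k) ^ 2 * r ^ k).
Proof.
  intros Hr.
  apply (ex_series_ext (fun k => Rabs (INR (S k) ^ 2 * r ^ k))).
  { intros k. apply Rabs_right, Rle_ge. apply Rmult_le_pos; apply pow_le; [apply pos_INR|lra]. }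
  assert (Hpos : forall k, 0 < INR (S k)) by (intros; apply lt_0_INR; lia).
  apply ex_series_DAlembert with (k := r); [lra| |].
  - intros k. apply Rmult_integral_contrapositive_currified; apply pow_nonzero;
      [apply Rgt_not_eq, Hpos|lra].
  - apply is_lim_seq_ext with (u := fun k => (1 + / INR (S k)) * (1 + / INR (S k)) * r).
    { intros k. specialize (Hpos k).
      replace (INR (S (S k)) ^ 2 * r ^ S k / (INR (S k) ^ 2 * r ^ k))
        with ((1 + / INR (S k)) * (1 + / INR (S k)) * r).
      2: { rewrite (S_INR (S k)). cbn [pow]. field.
           split; [apply pow_nonzero; lra|lra]. }
      symmetry. apply Rabs_right, Rle_ge.
      assert (0 < / INR (S k)) by now apply Rinv_0_lt_compat. nra. }
    assert (Hinv : is_lim_seq (fun k => 1 + / INR (S k)) 1).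
    { replace (Finite 1) with (Finite (1 + 0)) by (f_equal; ring).
      apply is_lim_seq_plus'; [apply is_lim_seq_const|].
      apply (is_lim_seq_incr_1 (fun k => / INR k)).
      apply (is_lim_seq_inv INR p_infty); [apply is_lim_seq_INR|discriminate]. }
    replace (Finite r) with (Finite (1 * 1 * r)) by (f_equal; ring).
    apply is_lim_seq_mult'; [|apply is_lim_seq_const]. now apply is_lim_seq_mult'.
Qed.

(** * The functional equation and differentiability of the series in the unit disc *)

Section Fixed_z.
Context (z : R) (hz : 0 < z < 1 / 4).

Lemma Qterm_wpoly (x y : C) (k : nat) : Qterm x y z k = (RtoC (z ^ k) * wpoly k x y)%C.
Proof.
  unfold Qterm, wpoly, wpoly_upto. f_equal. apply csum_ext. intros i _.
  rewrite (Cmult_comm _ (x ^ i)), <- csum_scal. apply csum_ext. intros j _. unfold qC. ring.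
Qed.

Lemma Q_CSeries (x y : C) : Q x y z = CSeries (fun k => RtoC (z ^ k) * wpoly k x y)%C.
Proof. rewrite <- (CSeries_ext _ _ (Qterm_wpoly x y)). reflexivity. Qed.

Lemma pow4z_ex_series : ex_series (fun k => (4 * z) ^ k).
Proof. apply ex_series_geom. rewrite Rabs_right; lra. Qed.

Lemma Cmod_zpow_mult (k : nat) (a : C) (M : R) :
  Cmod a <= M * 4 ^ k -> Cmod (RtoC (z ^ k) * a)%C <= M * (4 * z) ^ k.
Proof.
  intros H. rewrite Cmod_mult, Cmod_R, Rabs_right by (apply Rle_ge, pow_le; lra).
  rewrite Rpow_mult_distr. assert (0 <= z ^ k) by (apply pow_le; lra). nra.
Qed.

Lemma Q_summable (x y : C) : Cmod x <= 1 -> Cmod y <= 1 ->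
  Csummable (fun k => RtoC (z ^ k) * wpoly k x y)%C.
Proof.
  intros Hx Hy. apply (Csummable_le _ (fun k => 1 * (4 * z) ^ k)).
  - intros k. apply Cmod_zpow_mult. rewrite Rmult_1_l. now apply wpoly_le.
  - exact (ex_series_scal_l 1 _ pow4z_ex_series).
Qed.

(** Splitting off the empty walk leaves [x y] plus the sum of [wpoly_S] weighted by [z^(k+1)];
    absolute convergence follows from the bound [4^k] and [4 z < 1]. *)
Lemma functional_equation (x y : C) : Cmod x <= 1 -> Cmod y <= 1 ->
  (x * y * Q x y z)%C =
  (x * y + z * ((y + 1 + x * x * y + x * x * y * y) * Q x y z
   - (y + 1) * Q 0 y z - Q x 0 z + Q 0 0 z))%C.
Proof.
  intros Hx Hy.
  assert (H0 : Cmod 0 <= 1) by (rewrite Cmod_0; lra).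
  set (T := fun x y k => (RtoC (z ^ k) * wpoly k x y)%C).
  assert (HT : forall x y, Cmod x <= 1 -> Cmod y <= 1 -> Csummable (T x y))
    by (intros; now apply Q_summable).
  assert (E : (x * y * CSeries (fun k => T x y (S k)))%C =
    (z * (y + 1 + x * x * y + x * x * y * y) * Q x y z
     + (- (z * (y + 1)) * Q 0 y z + (- z * Q x 0 z + z * Q 0 0 z)))%C).
  { rewrite !Q_CSeries. fold (T x y) (T 0 y) (T x 0) (T 0 0).
    rewrite <- !CSeries_scal, <- !CSeries_plus;
      auto 10 using Csummable_plus, Csummable_scal.
    2: { apply (ex_series_incr_1 (fun k => Cmod (T x y k))). now apply HT. }
    apply CSeries_ext. intros k. unfold T. cbn [pow]. rewrite RtoC_mult.
    transitivity (z * RtoC (z ^ k) * (x * y * wpoly (S k) x y))%C; [ring|].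
    rewrite wpoly_S. ring. }
  assert (EQ : Q x y z = (1 + CSeries (fun k => T x y (S k)))%C).
  { rewrite Q_CSeries. fold (T x y). rewrite CSeries_incr by now apply HT.
    unfold T at 1. rewrite wpoly_0. cbn [pow]. ring. }
  rewrite EQ at 1. rewrite Cmult_plus_distr_l, E. ring.
Qed.

Lemma Q_kernel (x y : C) : Cmod x <= 1 -> Cmod y <= 1 ->
  (z * (y + 1 + x * x * y + x * x * y * y) - x * y)%C = RtoC 0 ->
  (z * Q x 0 z + z * ((y + 1) * Q 0 y z) - z * Q 0 0 z - x * y)%C = RtoC 0.
Proof.
  intros Hx Hy HK. assert (E := functional_equation x y Hx Hy). apply Ceq_minus in E.
  transitivity ((z * (y + 1 + x * x * y + x * x * y * y) - x * y) * Q x y z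
    + (x * y * Q x y z -
  (x * y + z * ((y + 1 + x * x * y + x * x * y * y) * Q x y z
   - (y + 1) * Q 0 y z - Q x 0 z + Q 0 0 z))))%C; [ring|].
  rewrite HK, E. ring.
Qed.

(** Common to both sections, with [c k i] equal to [q i 0 k] or [q 0 i k]. The degree in [v] grows
    with [k], so the remainder constants are of order [k^2 (4 z)^k], still summable. *)
Lemma Cdiff_power_sums (c : nat -> nat -> C) (w : C) :
  (forall k, sum_f_R0 (fun i => Cmod (c k i)) k <= 4 ^ k) -> Cmod w < 1 ->
  Cdiff (fun v => CSeries (fun k => RtoC (z ^ k) * csum (fun i => c k i * v ^ i) k)%C) w.
Proof.
  intros Hc Hw.
  assert (HM : ex_series (fun k => INR (S k) ^ 2 * (4 * z) ^ k))
    by (apply ex_series_sqr_geom; lra).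
  assert (HS : forall k, INR k <= INR (S k) /\ 1 <= INR (S k) ^ 2).
  { intros k. rewrite S_INR. pose proof (pos_INR k). split; nra. }
  apply CSeries_Cdiff
    with (D := fun k => (RtoC (z ^ k) * csum (fun i => c k i * Cpow_deriv w i) k)%C)
         (M := fun k => INR (S k) ^ 2 * (4 * z) ^ k); [|  | exact HM].
  - generalize (Cnear_Cmod_lt w 1 Hw). apply filter_imp. intros v Hv k. split.
    + apply (Csummable_le _ (fun k => 1 * (4 * z) ^ k)).
      2: exact (ex_series_scal_l 1 _ pow4z_ex_series).
      clear k. intros k. apply Cmod_zpow_mult. rewrite Rmult_1_l.
      eapply Rle_trans; [apply Cmod_csum|]. eapply Rle_trans; [|apply Hc].
      apply sum_Rle. intros i _. rewrite Cmod_mult, Cmod_pow.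
      pose proof (pow_le_1 (Cmod v) i (conj (Cmod_ge_0 v) (Rlt_le _ _ Hv))).
      pose proof (Cmod_ge_0 (c k i)). nra.
    + replace (RtoC (z ^ k) * csum (fun i => c k i * v ^ i) k -
        RtoC (z ^ k) * csum (fun i => c k i * w ^ i) k -
        (v - w) * (RtoC (z ^ k) * csum (fun i => c k i * Cpow_deriv w i) k))%C
      with (RtoC (z ^ k) * (csum (fun i => c k i * v ^ i) k - csum (fun i => c k i * w ^ i) k
        - (v - w) * csum (fun i => c k i * Cpow_deriv w i) k))%C by ring.
      replace (INR (S k) ^ 2 * (4 * z) ^ k * Cmod (v - w)%C ^ 2)
        with (INR (S k) ^ 2 * Cmod (v - w)%C ^ 2 * (4 * z) ^ k) by ring.
      apply Cmod_zpow_mult.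
      eapply Rle_trans; [apply csum_Cpow_quadratic; [lra|lra|apply Hc]|].
      replace (INR (S k) ^ 2 * Cmod (v - w)%C ^ 2 * 4 ^ k)
        with (INR (S k) ^ 2 * (4 ^ k * Cmod (v - w)%C ^ 2)) by ring.
      rewrite Rmult_assoc. apply Rmult_le_compat_r.
      * apply Rmult_le_pos; [apply pow_le; lra|apply pow2_ge_0].
      * apply pow_incr. split; [apply pos_INR|apply HS].
  - apply (Csummable_le _ (fun k => INR (S k) ^ 2 * (4 * z) ^ k)); [|exact HM].
    intros k. apply Cmod_zpow_mult.
    eapply Rle_trans; [apply Cmod_csum|].
    eapply Rle_trans;
      [apply sum_Rle with (Bn := fun i => Cmod (c k i) * INR (S k) ^ 2)|].
    + intros i Hi. rewrite Cmod_mult. apply Rmult_le_compat_l; [apply Cmod_ge_0|].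
      eapply Rle_trans; [apply Cpow_deriv_le; lra|].
      apply Rle_trans with (INR (S k)); [apply le_INR; lia|].
      pose proof (HS k). pose proof (pos_INR (S k)). rewrite S_INR in *.
      pose proof (pos_INR k). nra.
    + rewrite <- scal_sum. apply Rmult_le_compat_l; [apply pow2_ge_0|apply Hc].
Qed.

Lemma Cdiff_Q_x (w : C) : Cmod w < 1 -> Cdiff (fun x => Q x 0 z) w.
Proof.
  intros Hw.
  apply (Cdiff_ext_near
    (fun v => CSeries (fun k => RtoC (z ^ k) * csum (fun i => qC i 0 k * v ^ i) k)%C)).
  - apply filter_forall. intros v. rewrite Q_CSeries. apply CSeries_ext. intros k.
    now rewrite wpoly_x_0.
  - apply (Cdiff_power_sums (fun k i => qC i 0 k)); [|exact Hw]. intros k.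
    eapply Rle_trans; [|apply wmass_le]. apply sum_Rle. intros i _. rewrite Cmod_qC.
    apply (sum_f_R0_ge_first (fun j => INR (q i j k))). intros; apply pos_INR.
Qed.

Lemma Cdiff_Q_y (w : C) : Cmod w < 1 -> Cdiff (fun y => Q 0 y z) w.
Proof.
  intros Hw.
  apply (Cdiff_ext_near
    (fun v => CSeries (fun k => RtoC (z ^ k) * csum (fun j => qC 0 j k * v ^ j) k)%C)).
  - apply filter_forall. intros v. rewrite Q_CSeries. apply CSeries_ext. intros k.
    now rewrite wpoly_0_y.
  - apply (Cdiff_power_sums (fun k j => qC 0 j k)); [|exact Hw]. intros k.
    eapply Rle_trans; [|apply wmass_le].
    rewrite (sum_eq _ (fun j => INR (q 0 j k))) by (intros; apply Cmod_qC).
    apply (sum_f_R0_ge_first (fun i => sum_f_R0 (fun j => INR (q i j k)) k)).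
    intros i. apply cond_pos_sum. intros; apply pos_INR.
Qed.

End Fixed_z.

(** * Continuation *)

Lemma on_seg_Cmod_lt_1 (lo hi : R) (w : C) :
  -1 < lo -> hi < 1 -> on_seg lo hi w -> Cmod w < 1.
Proof.
  intros Hlo Hhi [Hi Hr]. pose proof (Cmod_sqr w) as H. rewrite Hi in H.
  pose proof (Cmod_ge_0 w). nra.
Qed.

(** Agreement with [d] in the open disc is built in. Differentiability on and beyond the unit circle
    follows once [d] and [e] agree on the part of a neighbourhood that lies in the disc. *)
Definition glue (d e : C -> C) (w : C) : C := if Rlt_dec (Cmod w) 1 then d w else e w.

Lemma glue_in (d e : C -> C) (w : C) : Cmod w < 1 -> glue d e w = d w.
Proof. intros H. unfold glue. now destruct Rlt_dec. Qed.

Lemma glue_out (d e : C -> C) (w : C) : (Cmod w < 1 -> d w = e w) -> glue d e w = e w.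
Proof. intros H. unfold glue. destruct Rlt_dec; auto. Qed.

Lemma Cdiff_glue_in (d e : C -> C) (w : C) : Cmod w < 1 -> Cdiff d w -> Cdiff (glue d e) w.
Proof.
  intros Hw. apply Cdiff_ext_near. generalize (Cnear_Cmod_lt w 1 Hw).
  apply filter_imp. intros v Hv. now rewrite glue_in.
Qed.

Lemma Cdiff_glue_out (d e : C -> C) (w : C) :
  Cnear w (fun v : C => Cmod v < 1 -> d v = e v) -> Cdiff e w -> Cdiff (glue d e) w.
Proof.
  intros Hw. apply Cdiff_ext_near. revert Hw.
  apply filter_imp. intros v Hv. now rewrite glue_out.
Qed.

Section Continuation.
Context (z : R) (hz : 0 < z < 1 / 4).

(** The inner cut lies in the open disc: [y2 < 1] amounts to [s^2 < s] for [s = sqrt (1 - 16 z^2)]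
    in [(0,1)]. *)
Lemma y_outside (y : C) : 1 <= Cmod y -> ~ on_seg (y1 z) (y2 z) y.
Proof.
  intros H Hs. apply on_seg_Cmod_lt_1 in Hs; [lra|unfold y1; lra|].
  unfold y2. assert (Hz2 : 0 < z ^ 2 < 1 / 16) by (split; nra).
  pose proof (sqrt_sqrt (1 - 16 * z ^ 2) ltac:(lra)).
  pose proof (sqrt_lt_R0 (1 - 16 * z ^ 2) ltac:(lra)).
  apply Rmult_lt_reg_r with (8 * z ^ 2); [lra|].
  replace ((1 - 8 * z ^ 2 - sqrt (1 - 16 * z ^ 2)) / (8 * z ^ 2) * (8 * z ^ 2))
    with (1 - 8 * z ^ 2 - sqrt (1 - 16 * z ^ 2)) by (field; lra). nra.
Qed.

Lemma x_outside (x : C) : 1 <= Cmod x -> ~ on_seg (x1 z) (x2 z) x.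
Proof.
  intros H Hs.
  assert (Hdiv : forall t, t / (2 * z) * (2 * z) = t) by (intros; field; lra).
  apply on_seg_Cmod_lt_1 in Hs; [lra| |].
  - unfold x1. pose proof (sqrt_sqrt (1 + 4 * z) ltac:(lra)).
    pose proof (sqrt_pos (1 + 4 * z)).
    apply Rmult_lt_reg_r with (2 * z); [lra|]. rewrite Hdiv. nra.
  - unfold x2. pose proof (sqrt_sqrt (1 - 4 * z) ltac:(lra)).
    pose proof (sqrt_lt_R0 (1 - 4 * z) ltac:(lra)).
    apply Rmult_lt_reg_r with (2 * z); [lra|]. rewrite Hdiv. nra.
Qed.

(** * The kernel [x y z (1/x + 1/(x y) + x + x y - 1/z)] and its two branches *)

Definition kernel (x y : C) : C := (z * (y + 1 + x * x * y + x * x * y * y) - x * y)%C.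

Lemma kernel_X0 (y : C) : separated (XA z y) (- y)%C (XD z y) -> kernel (X0 z y) y = RtoC 0.
Proof.
  intros H. apply small_root_spec in H. rewrite <- H.
  unfold kernel, XA, XD, X0. ring.
Qed.

Lemma kernel_Y0 (x : C) : separated (YA z x) (YB z x) z -> kernel x (Y0 z x) = RtoC 0.
Proof.
  intros H. apply small_root_spec in H. rewrite <- H.
  unfold kernel, YA, YB, Y0. ring.
Qed.

(** The strictly smaller root times the other one is [1 / y]. *)
Lemma X0_bound (y : C) : separated (XA z y) (- y)%C (XD z y) -> Cmod y * Cmod (X0 z y) ^ 2 < 1.
Proof.
  (* At [y = -1] the constant coefficient vanishes, outside the scope of [small_root_lt]; there the
     root is 0. *)
  intros H. destruct (Ceq_dec (y + 1)%C (RtoC 0)) as [E|E].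
  - assert (Hy : y = (- (1))%C) by (apply Ceq_minus; rewrite <- E; ring). subst y.
    assert (HX : X0 z (- (1))%C = RtoC 0).
    { apply small_root_spec in H. rewrite <- H. unfold XA, XD, X0. ring. }
    rewrite HX, Cmod_0. lra.
  - assert (Hz : RtoC z <> RtoC 0) by (apply RtoC_neq0; lra).
    apply small_root_lt in H; [|now apply Cmult_neq_0].
    change (small_root (XA z y) (- y)%C (XD z y)) with (X0 z y) in H.
    unfold XA, XD in H. rewrite !Cmod_mult, Cmod_R, Rabs_right in H by lra.
    apply Cmod_gt_0 in E. set (e := Cmod (y + 1)%C) in *.
    apply Rmult_lt_reg_l with (z * e); [nra|]. lra.
Qed.

(** The strictly smaller root times the other one is [1 / x^2]. *)
Lemma Y0_bound (x : C) : separated (YA z x) (YB z x) z -> Cmod x * Cmod (Y0 z x) < 1.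
Proof.
  intros H. assert (Hz : RtoC z <> RtoC 0) by (apply RtoC_neq0; lra).
  apply small_root_lt in H; [|exact Hz].
  change (small_root (YA z x) (YB z x) z) with (Y0 z x) in H.
  unfold YA in H. rewrite !Cmod_mult, Cmod_R, Rabs_right in H by lra.
  pose proof (Cmod_ge_0 x). pose proof (Cmod_ge_0 (Y0 z x)).
  assert (0 <= Cmod x * Cmod (Y0 z x)) by now apply Rmult_le_pos.
  assert ((Cmod x * Cmod (Y0 z x)) ^ 2 < 1); [|nra].
  apply Rmult_lt_reg_l with z; [lra|]. lra.
Qed.

(** Converse of [Y0_bound]: the product of the roots is [1 / x^2], so a root with [|x| |y| < 1] is
    strictly the smaller one. *)
Lemma Y0_of_kernel (x y : C) : kernel x y = RtoC 0 ->
  x <> RtoC 0 -> Cmod x * Cmod y < 1 -> Y0 z x = y.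
Proof.
  intros HK Hx Hxy. assert (Hz : RtoC z <> RtoC 0) by (apply RtoC_neq0; lra).
  assert (HA : (z * (x * x))%C <> RtoC 0) by (apply Cmult_neq_0; [|apply Cmult_neq_0]; assumption).
  assert (Hroot : (z * (x * x) * (y * y) + (z * (x * x) - x + z) * y + z)%C = RtoC 0)
    by (rewrite <- HK; unfold kernel; ring).
  unfold Y0. apply small_root_unique; [exact HA|exact Hroot|].
  set (o := (z * (x * x) * y + (z * (x * x) - x + z))%C).
  assert (Ho : (o * y)%C = (- z)%C).
  { apply Ceq_minus. rewrite <- Hroot. unfold o. ring. }
  assert (Hy : 0 < Cmod y).
  { apply Cmod_gt_0. intros E. rewrite E, Cmult_0_r in Ho. apply Hz.
    replace (RtoC z) with (- - z)%C by ring. rewrite <- Ho. ring. }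
  apply Rmult_lt_reg_r with (Cmod y); [exact Hy|].
  rewrite <- (Cmod_mult o), Ho, Cmod_opp, !Cmod_mult, Cmod_R, Rabs_right by lra.
  pose proof (Cmod_ge_0 x).
  assert (0 <= Cmod x * Cmod y) by nra.
  replace (z * (Cmod x * Cmod x) * Cmod y * Cmod y) with (z * (Cmod x * Cmod y) ^ 2) by ring.
  assert ((Cmod x * Cmod y) ^ 2 < 1); nra.
Qed.

Lemma X0_of_kernel (x y : C) : kernel x y = RtoC 0 ->
  y <> RtoC 0 -> Cmod y * Cmod x ^ 2 < 1 -> X0 z y = x.
Proof.
  intros HK Hy Hxy. assert (Hz : RtoC z <> RtoC 0) by (apply RtoC_neq0; lra).
  (* At [y = -1] the kernel reduces to [x], so [x = 0], which is also the value [small_root] takes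
     for a vanishing leading coefficient. *)
  destruct (Ceq_dec (y + 1)%C (RtoC 0)) as [E|E].
  - assert (Hy1 : y = (- (1))%C) by (apply Ceq_minus; rewrite <- E; ring).
    subst y.
    assert (Hx0 : x = RtoC 0) by (rewrite <- HK; unfold kernel; ring).
    rewrite Hx0. unfold X0, small_root.
    destruct (Cis0_spec (z * (- (1) * (- (1) + 1)))%C) as [_|E2]; [|exfalso; apply E2; ring].
    destruct (Cis0_spec (- - (1))%C) as [E2|_]; [|field; intros E2; now apply C1_nz].
    exfalso. apply C1_nz. rewrite <- E2. ring.
  - assert (HA : (z * (y * (y + 1)))%C <> RtoC 0)
      by (apply Cmult_neq_0; [|apply Cmult_neq_0]; assumption).
    assert (Hroot : (z * (y * (y + 1)) * (x * x) + - y * x + z * (y + 1))%C = RtoC 0)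
      by (rewrite <- HK; unfold kernel; ring).
    unfold X0. apply small_root_unique; [exact HA|exact Hroot|].
    set (o := (z * (y * (y + 1)) * x + - y)%C).
    assert (Ho : (o * x)%C = (- (z * (y + 1)))%C).
    { apply Ceq_minus. rewrite <- Hroot. unfold o. ring. }
    assert (Hx : 0 < Cmod x).
    { apply Cmod_gt_0. intros E2. rewrite E2, Cmult_0_r in Ho.
      apply (Cmult_neq_0 _ _ Hz E). replace (z * (y + 1))%C with (- - (z * (y + 1)))%C by ring.
      rewrite <- Ho. ring. }
    apply Rmult_lt_reg_r with (Cmod x); [exact Hx|].
    rewrite <- (Cmod_mult o), Ho, Cmod_opp, !Cmod_mult, Cmod_R, Rabs_right by lra.
    apply Cmod_gt_0 in E. set (e := Cmod (y + 1)%C) in *.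
    assert (0 < z * e) by nra.
    replace (z * (Cmod y * e) * Cmod x * Cmod x) with (z * e * (Cmod y * Cmod x ^ 2)) by ring.
    nra.
Qed.

(** * The continued functions and their two equations *)

Definition Fdisc (x : C) : C := (z * Q x 0 z)%C.
Definition Gdisc (y : C) : C := (z * ((y + 1) * Q 0 y z))%C.

Lemma disc_equation (x y : C) : Cmod x <= 1 -> Cmod y <= 1 -> kernel x y = RtoC 0 ->
  (Fdisc x + Gdisc y - z * Q 0 0 z - x * y)%C = RtoC 0.
Proof. exact (Q_kernel z hz x y). Qed.

Definition Fcont : C -> C := glue Fdisc (fun x => x * Y0 z x + z * Q 0 0 z - Gdisc (Y0 z x))%C.
Definition Gcont : C -> C := glue Gdisc (fun y => X0 z y * y + z * Q 0 0 z - Fdisc (X0 z y))%C.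

(** For [|x| < 1] the kernel identity equates the two expressions, so the formula holds on both
    sides of the unit circle. *)
Lemma Fcont_via_Y0 (x : C) : separated (YA z x) (YB z x) z -> Cmod (Y0 z x) <= 1 ->
  Fcont x = (x * Y0 z x + z * Q 0 0 z - Gdisc (Y0 z x))%C.
Proof.
  intros Hs HY. unfold Fcont. rewrite glue_out; [reflexivity|]. intros Hx.
  apply Ceq_minus. refine (eq_trans _ (disc_equation x (Y0 z x) (Rlt_le _ _ Hx) HY (kernel_Y0 x Hs))).
  ring.
Qed.

Lemma Gcont_via_X0 (y : C) : separated (XA z y) (- y)%C (XD z y) -> Cmod (X0 z y) <= 1 ->
  Gcont y = (X0 z y * y + z * Q 0 0 z - Fdisc (X0 z y))%C.
Proof.
  intros Hs HX. unfold Gcont. rewrite glue_out; [reflexivity|]. intros Hy.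
  apply Ceq_minus. refine (eq_trans _ (disc_equation (X0 z y) y HX (Rlt_le _ _ Hy) (kernel_X0 y Hs))).
  ring.
Qed.

Lemma Cdiff_Fdisc (x : C) : Cmod x < 1 -> Cdiff Fdisc x.
Proof.
  intros Hx. apply (Cdiff_mult (fun _ => RtoC z)); [apply Cdiff_const|now apply Cdiff_Q_x].
Qed.

Lemma Cdiff_Gdisc (y : C) : Cmod y < 1 -> Cdiff Gdisc y.
Proof.
  intros Hy. apply (Cdiff_mult (fun _ => RtoC z)); [apply Cdiff_const|].
  apply (Cdiff_mult (fun y => y + 1)%C); [|now apply Cdiff_Q_y].
  apply Cdiff_plus; [apply Cdiff_id|apply Cdiff_const].
Qed.

Lemma X0_lt_1 (y : C) : 1 <= Cmod y -> separated (XA z y) (- y)%C (XD z y) -> Cmod (X0 z y) < 1.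
Proof.
  intros Hy Hs. pose proof (X0_bound y Hs). pose proof (Cmod_ge_0 (X0 z y)). nra.
Qed.

Lemma Y0_lt_1 (x : C) : 1 <= Cmod x -> separated (YA z x) (YB z x) z -> Cmod (Y0 z x) < 1.
Proof.
  intros Hx Hs. pose proof (Y0_bound x Hs). pose proof (Cmod_ge_0 (Y0 z x)). nra.
Qed.

Lemma Cdiff_Fcont (x : C) : ~ on_seg (x3 z) (x4 z) x -> Cdiff Fcont x.
Proof.
  intros H. destruct (Rlt_le_dec (Cmod x) 1) as [Hx|Hx].
  - now apply Cdiff_glue_in, Cdiff_Fdisc.
  - assert (Hs := Y_separated z hz x (x_outside x Hx) H).
    assert (HY := Y0_lt_1 x Hx Hs).
    destruct (Cdiff_small_root (YA z) (YB z) (fun _ => RtoC z) x) as [HdY Hnear].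
    + unfold YA. apply (Cdiff_mult (fun _ => RtoC z)); [apply Cdiff_const|].
      apply Cdiff_mult; apply Cdiff_id.
    + unfold YB. apply Cdiff_plus; [|apply Cdiff_const]. apply Cdiff_minus; [|apply Cdiff_id].
      apply (Cdiff_mult (fun _ => RtoC z)); [apply Cdiff_const|].
      apply Cdiff_mult; apply Cdiff_id.
    + apply Cdiff_const.
    + exact Hs.
    + change (Cdiff (Y0 z) x) in HdY. apply Cdiff_glue_out.
      (* Near [x] the roots stay separated and [|Y0| < 1] persists by continuity, so the two
         expressions agree wherever such a point falls in the disc. *)
      * generalize (filter_and _ _ Hnear
          (Cdiff_near (Y0 z) x (fun v : C => Cmod v < 1) HdY (Cnear_Cmod_lt _ 1 HY))).
        apply filter_imp. intros v [Hv1 Hv2] Hv.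
        rewrite <- (Fcont_via_Y0 v Hv1 (Rlt_le _ _ Hv2)). symmetry. now apply glue_in.
      * apply Cdiff_minus.
        -- apply Cdiff_plus; [|apply Cdiff_const]. apply Cdiff_mult; [apply Cdiff_id|exact HdY].
        -- apply (Cdiff_comp Gdisc (Y0 z)); [now apply Cdiff_Gdisc|exact HdY].
Qed.

Lemma Cdiff_Gcont (y : C) : ~ on_ray (y3 z) y -> Cdiff Gcont y.
Proof.
  intros H. destruct (Rlt_le_dec (Cmod y) 1) as [Hy|Hy].
  - now apply Cdiff_glue_in, Cdiff_Gdisc.
  - assert (Hs := X_separated z hz y (y_outside y Hy) H).
    assert (HX := X0_lt_1 y Hy Hs).
    assert (Hy1 : Cdiff (fun v => v + 1)%C y)
      by (apply Cdiff_plus; [apply Cdiff_id|apply Cdiff_const]).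
    destruct (Cdiff_small_root (XA z) (fun v => - v)%C (XD z) y) as [HdX Hnear].
    + unfold XA. apply (Cdiff_mult (fun _ => RtoC z)); [apply Cdiff_const|].
      apply Cdiff_mult; [apply Cdiff_id|exact Hy1].
    + apply Cdiff_opp, Cdiff_id.
    + unfold XD. apply (Cdiff_mult (fun _ => RtoC z)); [apply Cdiff_const|exact Hy1].
    + exact Hs.
    + change (Cdiff (X0 z) y) in HdX. apply Cdiff_glue_out.
      * generalize (filter_and _ _ Hnear
          (Cdiff_near (X0 z) y (fun v : C => Cmod v < 1) HdX (Cnear_Cmod_lt _ 1 HX))).
        apply filter_imp. intros v [Hv1 Hv2] Hv.
        rewrite <- (Gcont_via_X0 v Hv1 (Rlt_le _ _ Hv2)). symmetry. now apply glue_in.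
      * apply Cdiff_minus.
        -- apply Cdiff_plus; [|apply Cdiff_const]. apply Cdiff_mult; [exact HdX|apply Cdiff_id].
        -- apply (Cdiff_comp Fdisc (X0 z)); [now apply Cdiff_Fdisc|exact HdX].
Qed.

Lemma equation_y (y : C) : ~ on_seg (y1 z) (y2 z) y -> ~ on_ray (y3 z) y ->
  (Fcont (X0 z y) + Gcont y - z * Q 0 0 z - X0 z y * y)%C = RtoC 0.
Proof.
  intros H1 H2. assert (Hs := X_separated z hz y H1 H2).
  assert (HK := kernel_X0 y Hs). assert (Hb := X0_bound y Hs).
  destruct (Rlt_le_dec (Cmod (X0 z y)) 1) as [HX|HX].
  - rewrite (Gcont_via_X0 y Hs (Rlt_le _ _ HX)). unfold Fcont. rewrite glue_in by exact HX. ring.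
  - pose proof (Cmod_ge_0 y).
    assert (Hy : Cmod y < 1) by nra.
    assert (HX0 : X0 z y <> RtoC 0) by (apply Cmod_gt_0; lra).
    assert (HYX : Y0 z (X0 z y) = y).
    (* As [|X0| >= 1], [|X0| |y| <= |X0|^2 |y| < 1]. *)
    { apply Y0_of_kernel; [exact HK|exact HX0|]. nra. }
    unfold Fcont at 1. rewrite glue_out, HYX.
    + unfold Gcont. rewrite glue_in by exact Hy. ring.
    + intros HX'. lra.
Qed.

Lemma equation_x (x : C) : ~ on_seg (x1 z) (x2 z) x -> ~ on_seg (x3 z) (x4 z) x ->
  (Fcont x + Gcont (Y0 z x) - z * Q 0 0 z - x * Y0 z x)%C = RtoC 0.
Proof.
  intros H1 H2. assert (Hs := Y_separated z hz x H1 H2).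
  assert (HK := kernel_Y0 x Hs). assert (Hb := Y0_bound x Hs).
  destruct (Rlt_le_dec (Cmod (Y0 z x)) 1) as [HY|HY].
  - rewrite (Fcont_via_Y0 x Hs (Rlt_le _ _ HY)). unfold Gcont. rewrite glue_in by exact HY. ring.
  - pose proof (Cmod_ge_0 x).
    assert (Hx : Cmod x < 1) by nra.
    assert (HY0 : Y0 z x <> RtoC 0) by (apply Cmod_gt_0; lra).
    assert (HXY : X0 z (Y0 z x) = x).
    (* As [|x| < 1], [|Y0| |x|^2 <= |Y0| |x| < 1]. *)
    { apply X0_of_kernel; [exact HK|exact HY0|]. nra. }
    unfold Gcont at 1. rewrite glue_out, HXY.
    + unfold Fcont. rewrite glue_in by exact Hx. ring.
    + intros HY'. lra.
Qed.

End Continuation.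

Theorem theorem3 (z : R) (hz : 0 < z < 1 / 4) :
  exists F G : C -> C,
    holo_on (fun x => ~ on_seg (x3 z) (x4 z) x) F /\
    holo_on (fun y => ~ on_ray (y3 z) y) G /\
    (forall x : C, Cmod x < 1 -> F x = Cmult (RtoC z) (Q x (RtoC 0) z)) /\
    (forall y : C, Cmod y < 1 ->
       G y = Cmult (RtoC z) (Cmult (Cplus y (RtoC 1)) (Q (RtoC 0) y z))) /\
    (forall y : C, ~ on_seg (y1 z) (y2 z) y -> ~ on_ray (y3 z) y ->
       Cminus (Cminus (Cplus (F (X0 z y)) (G y))
                      (Cmult (RtoC z) (Q (RtoC 0) (RtoC 0) z)))
              (Cmult (X0 z y) y) = RtoC 0) /\
    (forall x : C, ~ on_seg (x1 z) (x2 z) x -> ~ on_seg (x3 z) (x4 z) x ->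
       Cminus (Cminus (Cplus (F x) (G (Y0 z x)))
                      (Cmult (RtoC z) (Q (RtoC 0) (RtoC 0) z)))
              (Cmult x (Y0 z x)) = RtoC 0).
Proof.
  exists (Fcont z), (Gcont z). repeat split.
  - intros x Hx. now apply Cdiff_ex_derive, Cdiff_Fcont.
  - intros y Hy. now apply Cdiff_ex_derive, Cdiff_Gcont.
  - intros x Hx. exact (glue_in _ _ x Hx).
  - intros y Hy. exact (glue_in _ _ y Hy).
  - intros y H1 H2. now apply equation_y.
  - intros x H1 H2. now apply equation_x.
Qed.
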